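(* Let $P=\langle\mathbf{x},Q,q_{init},\Delta\rangle$ be an integer program and $q_{in},q_{out}\in Q$ be distinct control states. Then the result of the state-elimination algorithm TransitiveRelation (described in the context) on input $P,q_{in},q_{out}$ is a Presburger formula $\phi(\mathbf{x},\mathbf{x}')$ that defines an over-approximation of (i.e. a relation containing) $[\![P]\!]^+(q_{in},q_{out})$. If, moreover, $P$ is flat, then $\phi(\mathbf{x},\mathbf{x}')$ defines precisely $[\![P]\!]^+(q_{in},q_{out})$.
   Context: An integer program is a tuple $P=\langle\mathbf{x},Q,q_{init},\Delta\rangle$ where $\mathbf{x}$ is a finite set of $N$ integer variables, $Q$ a finite set of control states, $q_{init}\in Q$ the initial one, and $\Delta$ a finite set of transition rules $q\xrightarrow{R(\mathbf{x},\mathbf{x}')}q'$ with $R$ a quantifier-free Presburger formula over $\mathbf{x}$ and primed copies $\mathbf{x}'$. A configuration is a pair $\langle q,\nu\rangle$ with $q\in Q$ and $\nu\in\mathbb{Z}^{\mathbf{x}}$ a valuation. $\langle q',\nu'\rangle$ is an immediate successor of $\langle q,\nu\rangle$ if some $q\xrightarrow{R}q'\in\Delta$ has $(\nu,\nu')\models R$. A run of length $k$ is a sequence of $k+1$ configurations, each an immediate successor of the previous one. $[\![P]\!]^+(q,q')$ is the set of pairs $\langle\nu,\nu'\rangle$ such that there is a run of length $k\ge1$ from $\langle q,\nu\rangle$ to $\langle q',\nu'\rangle$. An octagonal constraint is a finite conjunction of atoms $u-v\le c$, $u+v\le c$, $-u-v\le c$ with $u,v\in\mathbf{x}\cup\mathbf{x}'$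 (possibly equal), $c\in\mathbb{Z}$; an octagonal relation is one definable by such a constraint. The octagonal hull of a relation is the strongest octagonal constraint defining a superset of it. A finite monoid affine relation is one defined by $\mathbf{x}'=A\mathbf{x}+\mathbf{b}\wedge\varphi(\mathbf{x})$ with $A\in\mathbb{Z}^{N\times N}$, $\mathbf{b}\in\mathbb{Z}^N$, $\varphi$ a quantifier-free Presburger formula, and $\{A^i\mid i\ge0\}$ finite. The reflexive and transitive closures of octagonal and of finite monoid affine relations are effectively Presburger definable. For an elementary cycle $\pi: q_1\xrightarrow{R_1}q_2\xrightarrow{R_2}\cdots q_n\xrightarrow{R_n}q_1$ (no control state repeated except first = last), $\lambda(\pi)$ is the formula $\exists\mathbf{x}_1,\dots,\mathbf{x}_{n-1}.\ R_1(\mathbf{x},\mathbf{x}_1)\wedge\dots\wedge R_n(\mathbf{x}_{n-1},\mathbf{x}')$. $P$ is flat if (1) each control state belongs to at most one elementary cycle and (2) for each elementary cycle $\pi$, $\lambda(\pi)$ defines an octagonal relation or a finite monoid affine relation. Algorithm TransitiveRelation, on input $P$ and distinct $q_{in},q_{out}\in Q$. Let $\mathcal{I}_{\mathbf{x}}$ denote $\bigwedge_{x\in\mathbf{x}}x'=x$. Make a working copy of $P$, with two fresh control states $\bar q_{in},\bar q_{out}$ and two additional transitions $\bar q_{in}\xrightarrow{\mathcal{I}_{\mathbf{x}}}q_{in}$ and $q_{out}\xrightarrow{\mathcal{I}_{\mathbf{x}}}\bar q_{out}$. Then, for each control state $q\notin\{\bar q_{in},\bar q_{out}\}$ of the working copy,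 do the following. Let $R_1,\dots,R_k$ be the labels of the current self-loops $q\to q$. If $k=0$, let $T=\mathcal{I}_{\mathbf{x}}$. Otherwise let $H=R_1$ if $k=1$ and $R_1$ is a finite monoid affine relation, and let $H$ be the octagonal hull of $R_1\vee\dots\vee R_k$ in all other cases; let $T=H^*$ be the reflexive and transitive closure of $H$. For every pair of transitions $q_1\xrightarrow{U}q$ and $q\xrightarrow{W}q_2$ with $q\notin\{q_1,q_2\}$, add the transition $q_1\to q_2$ labeled $\exists\mathbf{x}_1\exists\mathbf{x}_2.\ U(\mathbf{x},\mathbf{x}_1)\wedge T(\mathbf{x}_1,\mathbf{x}_2)\wedge W(\mathbf{x}_2,\mathbf{x}')$. Then remove $q$ and all transitions involving $q$. When all such states have been eliminated, return the disjunction of the labels of all transitions $\bar q_{in}\to\bar q_{out}$. *)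

(* Defs.v *)
From HB Require Import structures.
From Stdlib Require Export Relation_Operators.
From mathcomp Require Export all_boot all_order all_algebra finmap.
From mathcomp Require Export boolp classical_sets cardinality.

Set Implicit Arguments.
Unset Strict Implicit.
Unset Printing Implicit Defensive.

Import GRing.Theory.
Local Open Scope fset_scope.
Local Open Scope ring_scope.

(** * Presburger arithmetic *)

Definition join (A B T : Type) (f : A -> T) (g : B -> T) (u : A + B) : T :=
  match u with inl a => f a | inr b => g b end.

Inductive term (V : Type) : Type :=
| Var of V
| Cst of int
| Add of term V & term V
| Scale of int & term V.

(* [Ex n f] is the block "exists w_0 ... w_(n-1), f"; the bound variables are
   the right summand of the variables of [f]. Divisibility atoms are part of
   the quantifier-free language, as usual for quantifier elimination. *)
Inductive formula (V : Type) : Type :=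
| Top
| Bot
| Le of term V & term V
| Eq of term V & term V
| Dvd of int & term V
| Not of formula V
| And of formula V & formula V
| Or of formula V & formula V
| Ex (n : nat) of formula (V + 'I_n).

Arguments Cst {V}.
Arguments Top {V}.
Arguments Bot {V}.

(* Finite sets of rules need equality and choice on labels; these are the
   classical instances, and the equality is the syntactic one. *)
HB.instance Definition _ (V : Type) := gen_eqMixin (formula V).
HB.instance Definition _ (V : Type) := gen_choiceMixin (formula V).

Fixpoint eval (V : Type) (e : V -> int) (t : term V) : int :=
  match t with
  | Var v => e v
  | Cst c => c
  | Add t1 t2 => eval e t1 + eval e t2
  | Scale c t1 => c * eval e t1
  end.

Fixpoint holds (V : Type) (e : V -> int) (f : formula V) {struct f} : Prop :=
  match f with
  | Top => True
  | Bot => False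
  | Le t1 t2 => eval e t1 <= eval e t2
  | Eq t1 t2 => eval e t1 = eval e t2
  | Dvd d t => (d %| eval e t)%Z
  | Not f1 => ~ holds e f1
  | And f1 f2 => holds e f1 /\ holds e f2
  | Or f1 f2 => holds e f1 \/ holds e f2
  | Ex n f1 => exists w : 'I_n -> int, holds (join e w) f1
  end.

Fixpoint quantifier_free (V : Type) (f : formula V) : bool :=
  match f with
  | Not f1 => quantifier_free f1
  | And f1 f2 | Or f1 f2 => quantifier_free f1 && quantifier_free f2
  | Ex _ _ => false
  | _ => true
  end.

Fixpoint term_rename (V W : Type) (g : V -> W) (t : term V) : term W :=
  match t with
  | Var v => Var (g v)
  | Cst c => Cst c
  | Add t1 t2 => Add (term_rename g t1) (term_rename g t2)
  | Scale c t1 => Scale c (term_rename g t1)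
  end.

Fixpoint rename (V W : Type) (g : V -> W) (f : formula V) : formula W :=
  match f with
  | Top => Top
  | Bot => Bot
  | Le t1 t2 => Le (term_rename g t1) (term_rename g t2)
  | Eq t1 t2 => Eq (term_rename g t1) (term_rename g t2)
  | Dvd d t => Dvd d (term_rename g t)
  | Not f1 => Not (rename g f1)
  | And f1 f2 => And (rename g f1) (rename g f2)
  | Or f1 f2 => Or (rename g f1) (rename g f2)
  | Ex n f1 => Ex (rename (join (fun v => inl (g v)) inr) f1)
  end.

(** * Relations on valuations *)

Notation valuation N := 'cV[int]_N.

Definition env (N : nat) (nu : valuation N) : 'I_N -> int := fun i => nu i ord0.

(* [inl i] is the variable x_i and [inr i] its primed copy x'_i. *)
Notation relform N := (formula ('I_N + 'I_N)).

Definition relation_of (N : nat) (R : relform N) : valuation N -> valuation N -> Prop :=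
  fun nu nu' => holds (join (env nu) (env nu')) R.

(* "R defines the relation S" *)
Definition defines (N : nat) (R : relform N) (S : valuation N -> valuation N -> Prop) : Prop :=
  forall nu nu', relation_of R nu nu' <-> S nu nu'.

Definition id_form (N : nat) : relform N :=
  \big[@And _/Top]_(i < N) Eq (Var (inr i)) (Var (inl i)).

(* exists x1, R(x, x1) /\ S(x1, x') *)
Definition comp_form (N : nat) (R S : relform N) : relform N :=
  let x  := fun i : 'I_N => inl (inl i) in
  let x' := fun i : 'I_N => inl (inr i) in
  let x1 := fun i : 'I_N => inr i in
  Ex (And (rename (join x x1) R) (rename (join x1 x') S)).

(* exists x1 x2, U(x, x1) /\ T(x1, x2) /\ W(x2, x') *)
Definition comp3_form (N : nat) (U T W : relform N) : relform N :=
  let x  := fun i : 'I_N => inl (inl (inl i)) in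
  let x' := fun i : 'I_N => inl (inl (inr i)) in
  let x1 := fun i : 'I_N => inl (inr i) in
  let x2 := fun i : 'I_N => inr i in
  Ex (Ex (And (rename (join x x1) U)
         (And (rename (join x1 x2) T) (rename (join x2 x') W)))).

Definition disj_form (V : Type) (s : seq (formula V)) : formula V :=
  \big[@Or _/Bot]_(R <- s) R.

(** * Octagonal and finite monoid affine relations *)

Inductive oct_atom (V : Type) : Type :=
| OctSub of V & V & int  (* u - v <= c *)
| OctAdd of V & V & int  (* u + v <= c *)
| OctOpp of V & V & int. (* - u - v <= c *)

Definition oct_atom_holds (V : Type) (e : V -> int) (a : oct_atom V) : bool :=
  match a with
  | OctSub u v c => e u - e v <= c
  | OctAdd u v c => e u + e v <= c
  | OctOpp u v c => - e u - e v <= c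
  end.

(* A finite conjunction of atoms. *)
Notation oct_constraint N := (seq (oct_atom ('I_N + 'I_N))).

Definition oct_relation (N : nat) (C : oct_constraint N) : valuation N -> valuation N -> Prop :=
  fun nu nu' => all (oct_atom_holds (join (env nu) (env nu'))) C.

Definition octagonal (N : nat) (S : valuation N -> valuation N -> Prop) : Prop :=
  exists C : oct_constraint N, forall nu nu', S nu nu' <-> oct_relation C nu nu'.

Definition octagonal_hull (N : nat) (S : valuation N -> valuation N -> Prop)
    (C : oct_constraint N) : Prop :=
  (forall nu nu', S nu nu' -> oct_relation C nu nu') /\
  (forall D : oct_constraint N,
     (forall nu nu', S nu nu' -> oct_relation D nu nu') ->
     forall nu nu', oct_relation C nu nu' -> oct_relation D nu nu').

Definition finite_monoid_affine (N : nat) (S : valuation N -> valuation N -> Prop) : Prop :=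
  exists (A : 'M[int]_N) (b : 'cV[int]_N) (g : formula 'I_N),
    [/\ quantifier_free g,
        finite_set (range (fun i : nat => A ^+ i)) &
        forall nu nu', S nu nu' <-> nu' = A *m nu + b /\ holds (env nu) g].

(** * Integer programs *)

(* Transition rules q --R--> q', as triples (q, R, q'). *)
Notation transition N Q := (Q * relform N * Q)%type.

Definition source (N : nat) (Q : Type) (t : transition N Q) : Q := t.1.1.
Definition label (N : nat) (Q : Type) (t : transition N Q) : relform N := t.1.2.
Definition target (N : nat) (Q : Type) (t : transition N Q) : Q := t.2.

Record program (N : nat) (Q : finType) := Program {
  initial : Q;
  rules : {fset transition N Q};
  rules_qf : forall t, t \in rules -> quantifier_free (label t)
}.

Section Semantics.
Variables (N : nat) (Q : finType) (P : program N Q).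

Definition configuration : Type := (Q * valuation N)%type.

Definition successor (c c' : configuration) : Prop :=
  exists t, [/\ t \in rules P, source t = c.1, target t = c'.1 &
                relation_of (label t) c.2 c'.2].

(* [c :: s] is a run; its length is [size s]. *)
Fixpoint is_run (c : configuration) (s : seq configuration) : Prop :=
  match s with
  | [::] => True
  | c' :: s' => successor c c' /\ is_run c' s'
  end.

Definition reach_plus (q q' : Q) (nu nu' : valuation N) : Prop :=
  exists s : seq configuration,
    [/\ (1 <= size s)%N, is_run (q, nu) s & last (q, nu) s = (q', nu')].

Definition elementary_cycle (p : seq (transition N Q)) : Prop :=
  [/\ p != [::],
      {subset p <= rules P},
      cycle (fun t t' => target t == source t') p &
      uniq [seq source t | t <- p]].

(* The composition of the labels of a path; on the empty path, which is never
   a cycle, it is the identity. *)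
Fixpoint lambda (p : seq (transition N Q)) : relform N :=
  match p with
  | [::] => id_form N
  | [:: t] => label t
  | t :: p' => comp_form (label t) (lambda p')
  end.

(* Condition 1 identifies the rotations of a cycle (the same cycle read from
   another of its states); condition 2 ranges over all rotations. *)
Definition flat : Prop :=
  (forall p p' q, elementary_cycle p -> elementary_cycle p' ->
     q \in [seq source t | t <- p] -> q \in [seq source t | t <- p'] ->
     exists i, p' = rot i p) /\
  (forall p, elementary_cycle p ->
     octagonal (relation_of (lambda p)) \/
     finite_monoid_affine (relation_of (lambda p))).

End Semantics.

(** * State elimination *)

Section Elimination.
Variables (N : nat) (S : choiceType).
Implicit Types (D : {fset transition N S}) (q : S) (T : relform N).

Definition labels_between D q q' : {fset relform N} :=
  [fset label t | t in [fset t in D | (source t == q) && (target t == q')]].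

Definition union_of (L : {fset relform N}) : valuation N -> valuation N -> Prop :=
  fun nu nu' => exists2 R, R \in L & relation_of R nu nu'.

Definition single_fma (L : {fset relform N}) : Prop :=
  exists2 R, L = [fset R] & finite_monoid_affine (relation_of R).

(* [H] is the relation iterated for the nonempty set [L] of self-loop labels. *)
Definition loop_relation (L : {fset relform N})
    (H : valuation N -> valuation N -> Prop) : Prop :=
  (single_fma L /\ H = union_of L) \/
  (~ single_fma L /\ exists2 C, octagonal_hull (union_of L) C & H = oct_relation C).

(* [T] is a Presburger formula the algorithm may use for the self-loops of [q].
   Any formula that defines the closure is allowed. *)
Definition loop_closure D q T : Prop :=
  let L := labels_between D q q in
  (L = fset0 /\ T = id_form N) \/
  (L <> fset0 /\
   exists2 H, loop_relation L H & defines T (clos_refl_trans _ H)).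

Definition eliminate q T D : {fset transition N S} :=
  let ins  := [fset t in D | (target t == q) && (source t != q)] in
  let outs := [fset t in D | (source t == q) && (target t != q)] in
  [fset t in D | (source t != q) && (target t != q)] `|`
  [fset (source t, comp3_form (label t) T (label t'), target t')
     | t in ins, t' in outs].

Inductive eliminates : seq S -> {fset transition N S} -> {fset transition N S} -> Prop :=
| eliminates_nil D : eliminates [::] D D
| eliminates_cons q s D T D' :
    loop_closure D q T -> eliminates s (eliminate q T D) D' ->
    eliminates (q :: s) D D'.

End Elimination.

Section TransitiveRelation.
Variables (N : nat) (Q : finType) (P : program N Q) (qin qout : Q).

Definition wstate : choiceType := (Q + bool)%type.
Definition old (q : Q) : wstate := inl q.
Definition bar_in : wstate := inr true.
Definition bar_out : wstate := inr false.

Definition working_copy : {fset transition N wstate} :=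
  [fset (old (source t), label t, old (target t)) | t in rules P] `|`
  [fset (bar_in, id_form N, old qin); (old qout, id_form N, bar_out)].

(* [phi] is a possible output when the states are eliminated in the given order. *)
Definition transitive_relation (order : seq Q) (phi : relform N) : Prop :=
  exists2 D, eliminates [seq old q | q <- order] working_copy D &
             phi = disj_form (labels_between D bar_in bar_out).

End TransitiveRelation.

(* Main.v *)
From Stdlib Require Import Operators_Properties.
Require Import Defs.
From mathcomp Require Import zify.

(** Eliminating [q] preserves reachability between the other states as soon as
    the formula used for its self-loops contains the closure of their union,
    and preserves it exactly when that formula is exact. In a flat program
    every control state has at most one outgoing transition lying on a cycle;
    elimination keeps this property and the relations of the cycles, so [q]
    carries at most one self-loop when it is eliminated, and its label defines
    an octagonal or finite monoid affine relation, for which nothing is lost.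

    The algorithm can always proceed because both kinds of closures are
    Presburger definable. For [x' = A x + b] the powers of [A] are ultimately
    periodic, so the iterates move along finitely many arithmetic progressions.
    For an octagonal [R], a run of length [n] between two given states is an
    integer solution of a system with two variables and unit coefficients per
    inequality; if there is none, there is a refutation made of two
    combinations of bounded multiplicity whose bounds, after halving and
    rounding down, add up to a negative number. Read copy by copy, refutations
    are the paths of a finite graph, so by Kleene's algorithm their lengths and
    weights form a semilinear set, and "no path of length [n] refutes
    [(x, x')]" is a Presburger formula. *)

Set Implicit Arguments.
Unset Strict Implicit.
Unset Printing Implicit Defensive.
Import Order.TTheory GRing.Theory Num.Theory.
Local Open Scope ring_scope.

(** * Integer solutions of unit two-variable inequalities *)

(** Signed variables turn sums and differences of two variables into differences of two literals, so
    octagonal constraints become edges of a graph on literals. *)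
Definition literal (V : Type) : Type := (bool * V)%type.
Definition lneg (V : Type) (a : literal V) : literal V := (~~ a.1, a.2).
Definition lit_val (V : Type) (x : V -> int) (a : literal V) : int :=
  if a.1 then x a.2 else - x a.2.

Lemma lnegK (V : Type) : involutive (@lneg V).
Proof. by case=> s v; rewrite /lneg negbK. Qed.

Lemma lit_val_lneg (V : Type) (x : V -> int) a : lit_val x (lneg a) = - lit_val x a.
Proof. by case: a => -[] v; rewrite /lit_val //= opprK. Qed.

Lemma int_bounded_min (P : int -> Prop) (m z0 : int) :
  P z0 -> (forall z, P z -> m <= z) ->
  exists2 z, P z & forall z', P z' -> z <= z'.
Proof.
move=> Pz0 mP.
have ex : exists n, `[< P (m + n%:Z) >].
  exists `|z0 - m|%N; apply/asboolP.
  by have -> : m + `|z0 - m|%N = z0 by have := mP _ Pz0; lia.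
have /asboolP Pn := ex_minnP ex.
case: (ex_minnP ex) => n /asboolP Pn' nmin.
exists (m + n%:Z) => // z' Pz'.
have mz := mP _ Pz'.
have := nmin `|z' - m|%N.
have -> : m + `|z' - m|%N = z' by lia.
by move/asboolP: Pz' => -> /(_ isT); lia.
Qed.

Lemma int_between (L U : int -> Prop) (mL mU : int) :
  (forall l, L l -> l <= mL) -> (forall u, U u -> mU <= u) ->
  (forall l u, L l -> U u -> l <= u) ->
  exists z : int, (forall l, L l -> l <= z) /\ (forall u, U u -> z <= u).
Proof.
move=> LmL mUU LU; case: (pselect (exists u, U u)) => [[u0 Uu0]|nU].
  have [u Uu umin] := int_bounded_min Uu0 mUU.
  by exists u; split=> // l Ll; apply: LU.
by exists mL; split=> // u Uu; case: nU; exists u.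
Qed.

Section IntegerFarkas.
Variables (V F : finType) (src tgt : F -> literal V) (wt : F -> int).

Definition slope (y : V -> int) (f : F) : int := lit_val y (src f) - lit_val y (tgt f).

(** The edges of [A] yield [2 g <= 2 p + 1] and those of [B] yield [- 2 g <= 2 q + 1]. As [g] takes
    integer values, rounding gives [g <= p] and [- g <= q], which [p + q <= -1] contradicts. Sets of
    edges suffice because the walks used below can be made simple. *)
Definition certificate : Prop :=
  exists (A B : {set F}) (g : (V -> int) -> int) (p q : int),
    [/\ forall y, \sum_(f in A) slope y f = 2 * g y,
        forall y, \sum_(f in B) slope y f = - (2 * g y),
        \sum_(f in A) wt f <= 2 * p + 1,
        \sum_(f in B) wt f <= 2 * q + 1 & p + q <= -1].

Hypothesis skew : forall f, exists f',
  [/\ src f' = lneg (tgt f), tgt f' = lneg (src f) & wt f' = wt f].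

Fixpoint walk (a : literal V) (p : seq F) (b : literal V) : Prop :=
  match p with
  | [::] => a = b
  | f :: p' => src f = a /\ walk (tgt f) p' b
  end.

Definition weight (p : seq F) : int := \sum_(f <- p) wt f.

Lemma walk_cat a p q b : walk a (p ++ q) b <-> exists2 c, walk a p c & walk c q b.
Proof.
elim: p a => [|f p IH] a /=; first by split=> [|[c ->]] //; exists a.
by rewrite IH; split=> [[sf [c]]|[c [sf]]]; [exists c | split=> //; exists c].
Qed.

Lemma weight_cat p q : weight (p ++ q) = weight p + weight q.
Proof. by rewrite /weight big_cat. Qed.

Lemma weight_cons f p : weight (f :: p) = wt f + weight p.
Proof. by rewrite /weight big_cons. Qed.

Lemma walk_slope y a p b : walk a p b ->
  \sum_(f <- p) slope y f = lit_val y a - lit_val y b.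
Proof.
elim: p a => [|f p IH] a /=; first by move=> ->; rewrite big_nil subrr.
by case=> <- /IH; rewrite big_cons => ->; rewrite /slope addrA subrK.
Qed.

Lemma big_uniq_set (p : seq F) (E : F -> int) :
  uniq p -> \sum_(f in [set f in p]%SET) E f = \sum_(f <- p) E f.
Proof.
by move=> up; rewrite (big_uniq _ up) /=; apply: eq_bigl => f; rewrite inE.
Qed.

(** Both sizes matter for the inductions below: a nonempty [p2] makes the walk shorter once the
    cycle is removed, and a nonempty [p3] makes the cycle shorter than the walk. *)
Lemma walk_split a p b : walk a p b -> ~~ uniq [seq src f | f <- p] ->
  exists p1 p2 p3 c, [/\ p = p1 ++ p2 ++ p3, (0 < size p2)%N /\ (0 < size p3)%N,
    walk a p1 c, walk c p2 c & walk c p3 b].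
Proof.
elim: p a => [|f p IH] a //= [sf wp]; rewrite negb_and negbK => /orP[|nu].
  case/mapP=> g gp sg; case/splitPr: gp wp => p1 p2.
  case/walk_cat=> c wp1 /= [sgc wp2].
  exists [::], (f :: p1), (g :: p2), a; split=> //=; last by rewrite -sf sg.
  by split=> //; rewrite -sf sg sgc.
have [p1 [p2 [p3 [c [-> p2n w1 w2 w3]]]]] := IH _ wp nu.
by exists (f :: p1), p2, p3, c; split.
Qed.

Lemma simple_negative_cycle a p : walk a p a -> weight p < 0 ->
  exists b q, [/\ walk b q b, weight q < 0 & uniq [seq src f | f <- q]].
Proof.
have [n] := ubnP (size p); elim: n a p => // n IH a p szp wp neg.
have [u|nu] := boolP (uniq [seq src f | f <- p]); first by exists a, p.
have [p1 [p2 [p3 [c [ep [s2 s3] w1 w2 w3]]]]] := walk_split wp nu.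
move: szp neg; rewrite ep !weight_cat !size_cat => szp neg.
have [n2|p2pos] := ltP (weight p2) 0; first by apply: IH w2 n2; lia.
apply: (IH a (p1 ++ p3)); rewrite ?size_cat ?weight_cat; try lia.
by apply/walk_cat; exists c.
Qed.

Hypothesis consistent : ~ certificate.

Lemma walk_cycle_ge0 a p : walk a p a -> 0 <= weight p.
Proof.
move=> wp; have [//|neg] := leP 0 (weight p); case: consistent.
have [b [q [wq nq uq]]] := simple_negative_cycle wp neg.
(* The slopes of a cycle sum to zero and its weight is at most -1, which is [2 p + 1] for [p = -1];
   the empty set serves as second half with [q = 0]. *)
exists [set f in q]%SET, finset.set0, (fun=> 0), (-1), 0; split=> //.
- by move=> y; rewrite big_uniq_set ?(map_uniq uq)// (walk_slope y wq) subrr.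
- by move=> y; rewrite big_set0.
- by rewrite big_uniq_set ?(map_uniq uq)// -/(weight q); lia.
- by rewrite big_set0.
Qed.

(** Cutting out cycles never increases the weight, because no cycle is negative. *)
Lemma simple_walk a p b : walk a p b ->
  exists q, [/\ walk a q b, weight q <= weight p & uniq [seq src f | f <- q]].
Proof.
have [n] := ubnP (size p); elim: n p => // n IH p szp wp.
have [u|nu] := boolP (uniq [seq src f | f <- p]); first by exists p.
have [p1 [p2 [p3 [c [ep [s2 s3] w1 w2 w3]]]]] := walk_split wp nu.
have p2pos := walk_cycle_ge0 w2.
have [||q [wq leq uq]] := IH (p1 ++ p3); last first.
- by exists q; split=> //; move: leq; rewrite ep !weight_cat; lia.
- by apply/walk_cat; exists c.
- by move: szp; rewrite ep !size_cat; lia.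
Qed.

(** A walk from [a] to its negation bounds twice the value of [a], and a walk back bounds the
    opposite; together they would be a certificate whose form [g] is the value of [a]. *)
Lemma walk_tight_ge0 a p1 p2 (p q : int) :
  walk a p1 (lneg a) -> walk (lneg a) p2 a ->
  weight p1 <= 2 * p + 1 -> weight p2 <= 2 * q + 1 -> 0 <= p + q.
Proof.
move=> w1 w2 lp lq; have [//|neg] := leP 0 (p + q); case: consistent.
have [q1 [v1 l1 u1]] := simple_walk w1; have [q2 [v2 l2 u2]] := simple_walk w2.
exists [set f in q1]%SET, [set f in q2]%SET, (fun y => lit_val y a), p, q.
rewrite !big_uniq_set ?(map_uniq u1) ?(map_uniq u2)// -!/(weight _).
split; [move=> y | move=> y | lia | lia | lia].
- by rewrite big_uniq_set ?(map_uniq u1)// (walk_slope y v1) lit_val_lneg; lia.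
- by rewrite big_uniq_set ?(map_uniq u2)// (walk_slope y v2) lit_val_lneg; lia.
Qed.

Lemma walk_skew a p b : walk a p b ->
  exists2 q, walk (lneg b) q (lneg a) & weight q = weight p.
Proof.
elim: p a => [|f p IH] a /=; first by move=> ->; exists [::].
case=> <- /IH[q wq eq]; have [f' [sf tf ef]] := skew f.
exists (q ++ [:: f']); first by apply/walk_cat; exists (lneg (tgt f)).
by rewrite weight_cat eq !weight_cons ef addrC /weight big_nil addr0.
Qed.

Lemma weight_lower_bound : exists m : int, forall a p b, walk a p b -> m <= weight p.
Proof.
exists (- \sum_f `|wt f|) => a p b /simple_walk[q [_ le_qp /map_uniq uq]].
apply: le_trans le_qp; rewrite /weight -big_uniq_set // lerNl -sumrN.
apply: (@le_trans _ _ (\sum_(f in [set f in q]%SET) `|wt f|)).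
  by apply: ler_sum => f _; lia.
by rewrite [leRHS](bigID (mem [set f in q]%SET)) /= lerDl sumr_ge0.
Qed.

(* The tight closure: a constraint [val a - val b <= w] follows either from a
   walk, or from two walks bounding [2 val a] and [- 2 val b] after rounding. *)
Definition implied (a b : literal V) (w : int) : Prop :=
  (exists2 p, walk a p b & weight p <= w) \/
  (exists p1 p2 (p q : int), [/\ walk a p1 (lneg a), walk (lneg b) p2 b,
     weight p1 <= 2 * p + 1, weight p2 <= 2 * q + 1 & p + q <= w]).

Lemma implied_skew a b w : implied a b w -> implied (lneg b) (lneg a) w.
Proof.
case=> [[p /walk_skew[q wq <-] le]|[p1 [p2 [p [q [w1 w2 le1 le2 lew]]]]]].
  by left; exists q.
by right; exists p2, p1, q, p; rewrite !lnegK; split=> //; lia.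
Qed.

(** Composing a walk with a rounded pair extends one half of the pair by the walk at one end and by
    its contrapositive at the other. This adds twice the weight of the walk, so rounding is
    unaffected. Of two consecutive pairs the outer halves are kept; the inner ones have a
    nonnegative sum by [walk_tight_ge0]. *)
Lemma implied_trans a b c w w' :
  implied a b w -> implied b c w' -> implied a c (w + w').
Proof.
case=> [[p wp le]|[p1 [p2 [p [q [w1 w2 le1 le2 lew]]]]]].
  case=> [[r wr le']|[r1 [r2 [r [s [v1 v2 le1 le2 lew]]]]]].
    by left; exists (p ++ r); [apply/walk_cat; exists b | rewrite weight_cat; lia].
  right; have [t wt' et] := walk_skew wp.
  exists (p ++ r1 ++ t), r2, (w + r), s; split=> //; last lia.
    by apply/walk_cat; exists b => //; apply/walk_cat; exists (lneg b).
  by rewrite !weight_cat et; lia.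
case=> [[r wr le']|[r1 [r2 [r [s [v1 v2 le1' le2' lew']]]]]].
  right; have [t wt' et] := walk_skew wr.
  exists p1, (t ++ p2 ++ r), p, (q + w'); split=> //; last lia.
    by apply/walk_cat; exists (lneg b) => //; apply/walk_cat; exists b.
  by rewrite !weight_cat et; lia.
right; exists p1, r2, p, s; split=> //.
by have := walk_tight_ge0 v1 w2 le1' le2; lia.
Qed.

Lemma implied_refl_ge0 a w : implied a a w -> 0 <= w.
Proof.
case=> [[p /walk_cycle_ge0 wp le]|[p1 [p2 [p [q [w1 w2 le1 le2 lew]]]]]]; first lia.
by have := walk_tight_ge0 w1 w2 le1 le2; lia.
Qed.

(** Integer rounding of a bound on twice a value. A walk is used as both halves of a pair; from a
    pair, the half with the smaller bound is used twice. *)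
Lemma implied_even a w : implied a (lneg a) (2 * w + 1) -> implied a (lneg a) (2 * w).
Proof.
case=> [[p wp le]|[p1 [p2 [p [q [w1 w2 le1 le2 lew]]]]]].
  by right; exists p, p, w, w; rewrite lnegK; split=> //; lia.
rewrite lnegK in w2; right; have [pq|qp] := leP p q.
  by exists p1, p1, p, p; rewrite lnegK; split=> //; lia.
by exists p2, p2, q, q; rewrite lnegK; split=> //; lia.
Qed.

Lemma implied_lower_bound : exists m : int, forall a b w, implied a b w -> m <= w.
Proof.
have [m lem] := weight_lower_bound.
(* For a pair, [m <= 2 p + 1] and [m <= 2 q + 1] give [m - 1 <= p + q]. *)
exists (- `|m| - 1) => a b w.
case=> [[p /lem wp le]|[p1 [p2 [p [q [/lem w1 /lem w2 le1 le2 lew]]]]]]; lia.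
Qed.

(** Variables receive values one at a time, as in Fourier-Motzkin elimination. Since the implied
    constraints are closed under composition and rounding, every lower bound on the next variable is
    compatible with every upper bound. *)
Lemma implied_solution (s : seq V) :
  exists x : V -> int, forall (a b : literal V) (w : int), a.2 \in s -> b.2 \in s ->
    implied a b w -> lit_val x a - lit_val x b <= w.
Proof.
elim: s => [|v s [x solx]]; first by exists (fun=> 0).
have [vs|vs] := boolP (v \in s).
  have vsE u : u \in v :: s -> u \in s by rewrite inE => /predU1P[->|].
  by exists x => a b w /vsE a_s /vsE b_s; apply: solx.
pose t : literal V := (true, v).
have [m lem] := implied_lower_bound.
(* [M] bounds all values chosen so far; with [m] it confines the lower and upper bounds on the new
   value, as [int_between] requires. *)
pose M : int := \sum_(u : V) `|x u|.
have leM a : `|lit_val x a| <= M.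
  have -> : `|lit_val x a| = `|x a.2| by rewrite /lit_val; case: ifP; rewrite ?normrN.
  by rewrite /M (bigD1 a.2) //= lerDl sumr_ge0.
have M0 : 0 <= M by exact: le_trans (normr_ge0 _) (leM t).
(* An upper bound on the new value comes either from a literal that already has a value, or from
   half of an even bound on its double. *)
pose U (u : int) :=
  (exists (b : literal V) w, [/\ b.2 \in s, implied t b w & u = w + lit_val x b]) \/
  implied t (lneg t) (2 * u).
pose L (l : int) :=
  (exists (b : literal V) w, [/\ b.2 \in s, implied b t w & l = lit_val x b - w]) \/
  implied (lneg t) t (- (2 * l)).
have [|||z [Lz zU]] := @int_between L U (`|m| + M) (- (`|m| + M)).
- move=> l [[b [w [_ /lem lew ->]]]|/lem]; last lia.
  by have := leM b; lia.
- move=> u [[b [w [_ /lem lew ->]]]|/lem]; last lia.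
  by have := leM b; lia.
- move=> l u [[b [w [bs ib ->]]]|il] [[c [w' [cs ic ->]]]|iu].
  + by have := solx _ _ _ bs cs (implied_trans ib ic); lia.
  (* The chain [b], [t], [lneg t], [lneg b] yields a constraint on [b] alone, which [x] already
     satisfies; the next case is symmetric. *)
  + have := implied_trans (implied_trans ib iu) (implied_skew ib).
    by move/(solx b (lneg b) _ bs bs); rewrite lit_val_lneg; lia.
  + have := implied_trans (implied_trans (implied_skew ic) il) ic.
    by move/(solx (lneg c) c _ cs cs); rewrite lit_val_lneg; lia.
  + by have := implied_refl_ge0 (implied_trans il iu); lia.
pose x' (u : V) : int := if u == v then z else x u.
have x't : lit_val x' t = z by rewrite /lit_val /x' /= eqxx.
have x's (a : literal V) : a.2 \in s -> lit_val x' a = lit_val x a.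
  by rewrite /lit_val /x'; case: eqP => // -> /(negP vs).
have half (w : int) : exists u : int, 2 * u <= w <= 2 * u + 1.
  by exists (w %/ 2)%Z; lia.
have weaken a b w w' : w <= w' -> implied a b w -> implied a b w'.
  move=> le [[p wp le']|[p1 [p2 [p [q [w1 w2 le1 le2 lew]]]]]].
    by left; exists p => //; lia.
  by right; exists p1, p2, p, q; split=> //; lia.
have upper (b : literal V) w : b.2 \in s -> implied t b w -> z - lit_val x' b <= w.
  move=> bs ib; rewrite x's //; have := zU (w + lit_val x b).
  by move=> /(_ (or_introl (ex_intro _ b (ex_intro _ w (And3 bs ib erefl))))); lia.
have lower (b : literal V) w : b.2 \in s -> implied b t w -> lit_val x' b - z <= w.
  move=> bs ib; rewrite x's //; have := Lz (lit_val x b - w).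
  by move=> /(_ (or_introl (ex_intro _ b (ex_intro _ w (And3 bs ib erefl))))); lia.
have upper2 w : implied t (lneg t) w -> 2 * z <= w.
  move=> iw; have [u /andP[le1 le2]] := half w.
  by have := zU u (or_intror (implied_even (weaken _ _ _ _ le2 iw))); lia.
have lower2 w : implied (lneg t) t w -> - (2 * z) <= w.
  move=> iw; have [u /andP[le1 le2]] := half w.
  have iu : implied (lneg t) t (- (2 * - u)).
    rewrite mulrN opprK -{2}[t]lnegK; apply: implied_even; rewrite lnegK.
    exact: weaken le2 iw.
  by have := Lz (- u) (or_intror iu); lia.
have lits a : a.2 \in v :: s -> a.2 \in s \/ (a = t \/ a = lneg t).
  rewrite inE => /predU1P[|]; last by left.
  by case: a => -[] u /= ->; right; [left | right].
exists x' => a b w /lits[a_s|[->|->]] /lits[b_s|[->|->]].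
- by move=> iw; rewrite !x's //; apply: solx.
- by rewrite x't; apply: lower.
- by move/implied_skew; rewrite lnegK => /(upper (lneg a) _ a_s);
     rewrite !lit_val_lneg x't; lia.
- by rewrite x't; apply: upper.
- by move/implied_refl_ge0; rewrite subrr.
- by move/upper2; rewrite lit_val_lneg x't; lia.
- by move/implied_skew; rewrite lnegK => /(lower (lneg b) _ b_s);
     rewrite !lit_val_lneg x't; lia.
- by move/lower2; rewrite lit_val_lneg x't; lia.
- by move/implied_refl_ge0; rewrite subrr.
Qed.

End IntegerFarkas.

Theorem integer_farkas (V F : finType) (src tgt : F -> literal V) (wt : F -> int) :
  (forall f, exists f',
     [/\ src f' = lneg (tgt f), tgt f' = lneg (src f) & wt f' = wt f]) ->
  (exists x : V -> int, forall f, slope src tgt x f <= wt f) \/ certificate src tgt wt.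
Proof.
move=> skew; case: (pselect (certificate src tgt wt)) => [|cons]; first by right.
left; have [x solx] := implied_solution skew cons (enum V).
exists x => f; apply: solx; rewrite ?mem_enum //.
by left; exists [:: f]; rewrite /weight ?big_seq1 //=.
Qed.

(** * Definable and semilinear sets *)

Fixpoint term_subst (V W : Type) (s : V -> term W) (t : term V) : term W :=
  match t with
  | Var v => s v
  | Cst c => Cst c
  | Add t1 t2 => Add (term_subst s t1) (term_subst s t2)
  | Scale c t1 => Scale c (term_subst s t1)
  end.

Fixpoint subst (V W : Type) (s : V -> term W) (f : formula V) : formula W :=
  match f with
  | Top => Top
  | Bot => Bot
  | Le t1 t2 => Le (term_subst s t1) (term_subst s t2)
  | Eq t1 t2 => Eq (term_subst s t1) (term_subst s t2)
  | Dvd d t => Dvd d (term_subst s t)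
  | Not f1 => Not (subst s f1)
  | And f1 f2 => And (subst s f1) (subst s f2)
  | Or f1 f2 => Or (subst s f1) (subst s f2)
  | Ex n f1 =>
      Ex (subst (join (fun v => term_rename inl (s v)) (fun i : 'I_n => Var (inr i))) f1)
  end.

Lemma eval_term_rename (V W : Type) (g : V -> W) (e : W -> int) t :
  eval e (term_rename g t) = eval (e \o g) t.
Proof. by elim: t => //= [t1 -> t2 ->|c t ->]. Qed.

Lemma eval_term_subst (V W : Type) (s : V -> term W) (e : W -> int) t :
  eval e (term_subst s t) = eval (fun v => eval e (s v)) t.
Proof. by elim: t => //= [t1 -> t2 ->|c t ->]. Qed.

Lemma holds_subst (V : Type) (f : formula V) :
  forall (W : Type) (s : V -> term W) (e : W -> int),
  holds e (subst s f) <-> holds (fun v => eval e (s v)) f.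
Proof.
elim: f => {V}
    [V|V|V t1 t2|V t1 t2|V d t|V f IH|V f IHf g IHg|V f IHf g IHg|V n f IH] W s e /=;
  rewrite ?eval_term_subst ?IH ?IHf ?IHg //.
suff E (w : 'I_n -> int) : (fun v => eval (join e w)
    (join (fun v => term_rename inl (s v)) (fun i : 'I_n => Var (inr i)) v)) =
    join (fun v => eval e (s v)) w.
  by split=> -[w]; rewrite ?IH => h; exists w; move: h; rewrite ?IH E.
by apply: funext => -[v|i] //=; rewrite eval_term_rename.
Qed.

Lemma holds_rename (V : Type) (f : formula V) :
  forall (W : Type) (g : V -> W) (e : W -> int),
  holds e (rename g f) <-> holds (e \o g) f.
Proof.
elim: f => {V}
    [V|V|V t1 t2|V t1 t2|V d t|V f IH|V f IHf g IHg|V f IHf g IHg|V n f IH] W s e /=;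
  rewrite ?eval_term_rename ?IH ?IHf ?IHg //.
suff E (w : 'I_n -> int) : join e w \o join (fun v => inl (s v)) inr = join (e \o s) w.
  by split=> -[w]; rewrite ?IH => h; exists w; move: h; rewrite ?IH E.
by apply: funext => -[v|i].
Qed.

Section Definability.
Variable V : Type.
Implicit Types (S : (V -> int) -> Prop) (t : (V -> int) -> int).

(** Definability is kept semantic, so that large formulas are obtained from closure properties
    instead of being written out. *)
Definition definable S : Prop := exists f : formula V, forall e, holds e f <-> S e.
Definition affine t : Prop := exists tm : term V, forall e, eval e tm = t e.

Lemma affine_var v : affine (fun e => e v).
Proof. by exists (Var v). Qed.

Lemma affine_cst c : affine (fun=> c).
Proof. by exists (Cst c). Qed.

Lemma affine_add t1 t2 : affine t1 -> affine t2 -> affine (fun e => t1 e + t2 e).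
Proof. by case=> a ea [b eb]; exists (Add a b) => e /=; rewrite ea eb. Qed.

Lemma affine_scale c t : affine t -> affine (fun e => c * t e).
Proof. by case=> a ea; exists (Scale c a) => e /=; rewrite ea. Qed.

Lemma affine_opp t : affine t -> affine (fun e => - t e).
Proof. by case=> a ea; exists (Scale (-1) a) => e /=; rewrite ea mulN1r. Qed.

Lemma affine_sub t1 t2 : affine t1 -> affine t2 -> affine (fun e => t1 e - t2 e).
Proof. by move=> a1 a2; apply: affine_add => //; apply: affine_opp. Qed.

Lemma affine_sum (I : Type) (r : seq I) (P : pred I) (F : I -> (V -> int) -> int) :
  (forall i, affine (F i)) -> affine (fun e => \sum_(i <- r | P i) F i e).
Proof.
move=> aF; elim: r => [|i r [tm etm]].
  by exists (Cst 0) => e; rewrite big_nil.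
have [a ea] := aF i; exists (if P i then Add a tm else tm) => e.
by rewrite big_cons; case: (P i); rewrite /= ?ea etm.
Qed.

Lemma definable_ext S S' : (forall e, S e <-> S' e) -> definable S -> definable S'.
Proof. by move=> eS [f ef]; exists f => e; rewrite ef eS. Qed.

Lemma definable_cst (P : Prop) : definable (fun=> P).
Proof. by case: (pselect P) => p; [exists Top | exists Bot]. Qed.

Lemma definable_le t1 t2 : affine t1 -> affine t2 -> definable (fun e => t1 e <= t2 e).
Proof. by case=> a ea [b eb]; exists (Le a b) => e /=; rewrite ea eb. Qed.

Lemma definable_eq t1 t2 : affine t1 -> affine t2 -> definable (fun e => t1 e = t2 e).
Proof. by case=> a ea [b eb]; exists (Eq a b) => e /=; rewrite ea eb. Qed.

Lemma definable_not S : definable S -> definable (fun e => ~ S e).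
Proof. by case=> f ef; exists (Not f) => e /=; rewrite ef. Qed.

Lemma definable_and S S' : definable S -> definable S' -> definable (fun e => S e /\ S' e).
Proof. by case=> f ef [g eg]; exists (And f g) => e /=; rewrite ef eg. Qed.

Lemma definable_or S S' : definable S -> definable S' -> definable (fun e => S e \/ S' e).
Proof. by case=> f ef [g eg]; exists (Or f g) => e /=; rewrite ef eg. Qed.

Lemma definable_exists2_seq (T : eqType) (s : seq T) (F : T -> (V -> int) -> Prop) :
  (forall x, x \in s -> definable (F x)) -> definable (fun e => exists2 x, x \in s & F x e).
Proof.
elim: s => [|x s IH] dF.
  by apply: definable_ext (definable_cst False) => e; split=> // -[].
have dx : definable (F x) by apply: dF; rewrite mem_head.
have ds := IH (fun y ys => dF y (mem_behead (s := x :: s) ys)).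
apply: definable_ext (definable_or dx ds) => e; split.
  by case=> [Fx|[y ys Fy]]; [exists x | exists y]; rewrite ?inE ?ys ?eqxx ?orbT.
by case=> y; rewrite inE => /predU1P[->|ys] Fy; [left | right; exists y].
Qed.

Lemma definable_exists_fin (T : finType) (F : T -> (V -> int) -> Prop) :
  (forall x, definable (F x)) -> definable (fun e => exists x, F x e).
Proof.
move=> dF; apply: definable_ext (definable_exists2_seq (s := enum T) (fun x _ => dF x)) => e.
by split=> [[x _]|[x]]; exists x; rewrite ?mem_enum.
Qed.

Lemma definable_forall_fin (T : finType) (F : T -> (V -> int) -> Prop) :
  (forall x, definable (F x)) -> definable (fun e => forall x, F x e).
Proof.
move=> dF; have := definable_not (definable_exists_fin (fun x => definable_not (dF x))).
apply: definable_ext => e; split=> [h x|h [x]]; last by apply.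
by apply: contrapT => nF; apply: h; exists x.
Qed.

End Definability.

Lemma definable_exists_int (V : Type) (S : (V -> int) -> int -> Prop) :
  definable (fun e : V + 'I_1 -> int => S (e \o inl) (e (inr ord0))) ->
  definable (fun e => exists z, S e z).
Proof.
case=> f ef; exists (Ex f) => e /=; split=> [[w]|[z Sz]].
  by rewrite ef => Sw; exists (w ord0).
by exists (fun=> z); rewrite ef.
Qed.

Lemma definable_subst (V W : Type) (S : (V -> int) -> Prop) (s : V -> (W -> int) -> int) :
  definable S -> (forall v, affine (s v)) -> definable (fun e => S (fun v => s v e)).
Proof.
case=> f ef /choice[t et]; exists (subst t f) => e; rewrite holds_subst ef.
by rewrite (_ : (fun v => _) = (fun v => s v e)) //; apply: funext => v; rewrite et.
Qed.

Lemma affine_rename (V W : Type) (g : V -> W) (t : (V -> int) -> int) :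
  affine t -> affine (fun e => t (e \o g)).
Proof. by case=> a ea; exists (term_rename g a) => e; rewrite eval_term_rename ea. Qed.

(** * Semilinear subsets of a commutative group *)

Section Semilinear.
Variable M : zmodType.
Implicit Types (P : seq M) (S : M -> Prop).

Fixpoint monoid_span P (x : M) : Prop :=
  match P with
  | [::] => x = 0
  | p :: P' => exists k : nat, monoid_span P' (x - p *+ k)
  end.

Lemma monoid_span0 P : monoid_span P 0.
Proof. by elim: P => //= p P IH; exists 0%N; rewrite mulr0n subr0. Qed.

Lemma monoid_spanD P x y : monoid_span P x -> monoid_span P y -> monoid_span P (x + y).
Proof.
elim: P x y => [|p P IH] x y /=; first by move=> -> ->; rewrite addr0.
case=> k kx [l ly]; exists (k + l)%N.
by rewrite mulrnDr opprD addrACA; apply: IH.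
Qed.

Lemma monoid_span_cat P P' x : monoid_span (P ++ P') x <->
  exists y z, [/\ monoid_span P y, monoid_span P' z & x = y + z].
Proof.
elim: P x => [|p P IH] x /=.
  split=> [Px|[y [z [-> Pz ->]]]]; last by rewrite add0r.
  by exists 0, x; rewrite add0r.
split=> [[k /IH[y [z [Py Pz e]]]]|[y [z [[k Py] Pz ->]]]].
  exists (y + p *+ k), z; split=> //; first by exists k; rewrite addrK.
  by rewrite addrAC -e subrK.
by exists k; apply/IH; exists (y - p *+ k), z; rewrite addrAC.
Qed.

Definition semilinear S : Prop :=
  exists s : seq (M * seq M), forall x,
    S x <-> exists2 bP, bP \in s & monoid_span bP.2 (x - bP.1).

Inductive star S : M -> Prop :=
| star0 : star S 0
| starD x y : S x -> star S y -> star S (x + y).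

Lemma star_add S x y : star S x -> star S y -> star S (x + y).
Proof. by elim=> [|u v Su _ IH] sy; rewrite ?add0r // -addrA; apply: starD (IH sy). Qed.

Lemma semilinear_ext S S' : (forall x, S x <-> S' x) -> semilinear S -> semilinear S'.
Proof. by move=> e [s es]; exists s => x; rewrite -e es. Qed.

Lemma semilinear_empty : semilinear (fun=> False).
Proof. by exists [::] => x; split=> // -[]. Qed.

Lemma semilinear_point m : semilinear (fun x => x = m).
Proof.
exists [:: (m, [::])] => x; split=> [->|[bP]].
  by exists (m, [::]); rewrite ?mem_head //= subrr.
by rewrite inE => /eqP -> /= /eqP; rewrite subr_eq0 => /eqP.
Qed.

Lemma semilinear_union S S' :
  semilinear S -> semilinear S' -> semilinear (fun x => S x \/ S' x).
Proof.
case=> s es [s' es']; exists (s ++ s') => x; rewrite es es'; split.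
  by case=> -[bP bPs h]; exists bP; rewrite // mem_cat bPs ?orbT.
by case=> bP; rewrite mem_cat => /orP[] bPs h; [left | right]; exists bP.
Qed.

Lemma semilinear_sum S S' : semilinear S -> semilinear S' ->
  semilinear (fun x => exists y z, [/\ S y, S' z & x = y + z]).
Proof.
case=> s es [s' es'].
exists [seq (a.1 + b.1, a.2 ++ b.2) | a <- s, b <- s'] => x; split.
  case=> y [z [/es[a a_s ha] /es'[b b_s hb] ->]].
  exists (a.1 + b.1, a.2 ++ b.2); first by apply/allpairsP; exists (a, b).
  apply/monoid_span_cat; exists (y - a.1), (z - b.1); split=> //=.
  by rewrite addrACA opprD.
case=> bP /allpairsP[[a b] [/= a_s b_s ->]] /monoid_span_cat[y [z [hy hz /= e]]].
exists (y + a.1), (z + b.1); split.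
- by apply/es; exists a => //; rewrite addrK.
- by apply/es'; exists b => //; rewrite addrK.
- by rewrite addrACA -e subrK.
Qed.

Lemma star_union S S' x : star (fun x => S x \/ S' x) x <->
  exists y z, [/\ star S y, star S' z & x = y + z].
Proof.
split=> [|[y [z [Sy Sz ->]]]].
  elim=> [|u v Suv _ [y [z [Sy Sz ->]]]].
    by exists 0, 0; split; [left | left | rewrite addr0].
  case: Suv => Su; first by exists (u + y), z; rewrite addrA; split=> //; right.
  by exists y, (u + z); rewrite addrCA; split=> //; right.
apply: star_add.
  by elim: Sy => [|u v Su _ IH]; [left | right => //; left].
by elim: Sz => [|u v Su _ IH]; [left | right => //; right].
Qed.

(** A sum of [k + 1] elements of the linear set is [b], plus [k] times [b], plus a combination of
    [P]: the base point becomes an additional period. The empty sum is kept apart. *)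
Lemma star_linear b P x : star (fun x => monoid_span P (x - b)) x <->
  x = 0 \/ monoid_span (b :: P) (x - b).
Proof.
split=> [|[->|]]; first 1 last.
- by left.
- case=> k; elim: k x => [|k IH] x.
    rewrite mulr0n subr0 => h; rewrite -[x]addr0; right => //; left.
  rewrite mulrS => h.
  rewrite -[x](subrK b) addrC; right; first by rewrite subrr; apply: monoid_span0.
  by apply: IH; move: h; rewrite opprD addrA.
- elim=> [|u v Su _ [->|[k hv]]]; first by left.
    by right; exists 0%N; rewrite mulr0n subr0 addr0.
  right; exists k.+1; rewrite mulrS.
  have -> : u + v - b - (b + b *+ k) = (u - b) + (v - b - b *+ k).
    by rewrite !opprD !addrA; congr (_ - _); rewrite addrAC [u + v - b]addrAC addrAC.
  exact: monoid_spanD.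
Qed.

(* Commutativity turns the star of a union into the sum of the stars, so it
   suffices to iterate a single linear set. *)
Lemma semilinear_star S : semilinear S -> semilinear (star S).
Proof.
case=> s; elim: s S => [|[b P] s IH] S es.
  apply: semilinear_ext (semilinear_point 0) => x; split=> [->|]; first by left.
  by case=> // u v /es[].
pose S1 x := exists2 bP, bP \in s & monoid_span bP.2 (x - bP.1).
have s1 : semilinear (star S1) by apply: IH.
have s2 : semilinear (star (fun x => monoid_span P (x - b))).
  have h : semilinear (fun x => monoid_span (b :: P) (x - b)).
    exists [:: (b, b :: P)] => x; split=> [h|[bP]].
      by exists (b, b :: P); rewrite ?mem_head.
    by rewrite inE => /eqP ->.
  apply: semilinear_ext (semilinear_union (semilinear_point 0) h) => x.
  by rewrite star_linear.
apply: semilinear_ext (semilinear_sum s2 s1) => x; rewrite -star_union.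
suff -> : S = (fun x => monoid_span P (x - b) \/ S1 x) by [].
apply: funext => y; apply/propext; rewrite es; split.
  by case=> bP; rewrite inE => /predU1P[->|bPs] h; [left | right; exists bP].
by case=> [h|[bP bPs h]]; [exists (b, P) | exists bP]; rewrite ?inE ?eqxx ?bPs ?orbT.
Qed.

End Semilinear.

Definition affine_vec (V : Type) (d : nat) (t : (V -> int) -> 'cV[int]_d) : Prop :=
  forall i, affine (fun e => t e i ord0).

Lemma definable_eq_vec (V : Type) (d : nat) (t u : (V -> int) -> 'cV[int]_d) :
  affine_vec t -> affine_vec u -> definable (fun e => t e = u e).
Proof.
move=> at_ au.
have := definable_forall_fin (fun i => definable_eq (at_ i) (au i)).
apply: definable_ext => e; split=> [h|-> //].
by apply/matrixP => i j; rewrite ord1.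
Qed.

Lemma definable_monoid_span (V : Type) (d : nat) (P : seq 'cV[int]_d)
    (t : (V -> int) -> 'cV[int]_d) :
  affine_vec t -> definable (fun e => monoid_span P (t e)).
Proof.
elim: P V t => [|p P IH] V t at_ /=.
  by apply: definable_eq_vec => // i; rewrite /=; under eq_fun do rewrite mxE; apply: affine_cst.
have dk : definable (fun e => exists k : int, 0 <= k /\ monoid_span P (t e - k *: p)).
  apply: definable_exists_int; apply: definable_and.
    exact: definable_le (affine_cst _ 0) (affine_var _).
  apply: IH => i; have := affine_sub (affine_rename inl (at_ i))
    (affine_scale (p i ord0) (affine_var (inr ord0 : V + 'I_1))).
  by case=> tm etm; exists tm => e; rewrite etm !mxE mulrC.
apply: definable_ext dk => e; split=> [[[k|k] [k0 h]]|[k h]] //.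
  by exists k; rewrite -scaler_nat natz.
by exists k%:Z; rewrite -natz scaler_nat.
Qed.

Lemma definable_semilinear (V : Type) (d : nat) (S : 'cV[int]_d -> Prop)
    (t : (V -> int) -> 'cV[int]_d) :
  semilinear S -> affine_vec t -> definable (fun e => S (t e)).
Proof.
case=> s es at_.
have dd bP : definable (fun e => monoid_span bP.2 (t e - bP.1)).
  apply: definable_monoid_span => i; have := affine_sub (at_ i) (affine_cst _ (bP.1 i ord0)).
  by case=> tm etm; exists tm => e; rewrite etm !mxE.
by apply: definable_ext (definable_exists2_seq (s := s) (fun bP _ => dd bP)) => e; rewrite es.
Qed.

(** * Weights of paths in a finite graph *)

Section PathWeights.
Variables (T : finType) (ok : T -> T -> Prop) (M : zmodType) (wt : T -> M).

(* Weights of the paths from [a] to [b] with interior vertices in [X]; the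
   weight of [a] is not counted. *)
Inductive path_weight (X : seq T) : T -> T -> M -> Prop :=
| path_weight_one a b : ok a b -> path_weight X a b (wt b)
| path_weight_step a b c m : ok a c -> c \in X -> path_weight X c b m ->
    path_weight X a b (wt c + m).

Lemma path_weight_cat X a b c m n : c \in X ->
  path_weight X a c m -> path_weight X c b n -> path_weight X a b (m + n).
Proof.
move=> cX pm pn; elim: pm cX pn => [{}a {}c ac|{}a {}c d {}m ad dX _ IH] cX pn.
  exact: path_weight_step.
by rewrite -addrA; apply: path_weight_step (IH _ _).
Qed.

Lemma path_weight_sub X Y a b m : {subset X <= Y} ->
  path_weight X a b m -> path_weight Y a b m.
Proof.
move=> XY; elim=> [{}a {}b ab|{}a {}b c {}m ac cX _ IH]; first exact: path_weight_one.
by apply: path_weight_step => //; apply: XY.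
Qed.

(** A path through [q] is cut at its visits to [q]: a part up to the first visit, loops between
    successive visits, and a part after the last one. *)
Lemma path_weight_kleene q X a b m : path_weight (q :: X) a b m <->
  path_weight X a b m \/
  exists m1 m23, [/\ path_weight X a q m1,
    (exists m2 m3, [/\ star (path_weight X q q) m2, path_weight X q b m3 & m23 = m2 + m3]) &
    m = m1 + m23].
Proof.
have sub : {subset X <= q :: X} by move=> x xX; rewrite inE xX orbT.
split.
  elim=> [{}a {}b ab|{}a {}b c {}m ac]; first by left; apply: path_weight_one.
  rewrite inE => /predU1P[ec|cX] _ IH.
    rewrite {c}ec in ac IH *; right; exists (wt q), m; split=> //.
      exact: path_weight_one.
    case: IH => [pm|[m1 [m23 [pm1 [m2 [m3 [pm2 pm3 ->]]] ->]]]].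
      by exists 0, m; rewrite add0r; split=> //; left.
    by exists (m1 + m2), m3; rewrite addrA; split=> //; right.
  case: IH => [pm|[m1 [m23 [pm1 p23 ->]]]]; first by left; apply: path_weight_step.
  by right; exists (wt c + m1), m23; rewrite addrA; split=> //; apply: path_weight_step.
case=> [|[m1 [m23 [pm1 [m2 [m3 [pm2 pm3 ->]]] ->]]]]; first exact: path_weight_sub.
apply: (path_weight_cat (mem_head q X)); first exact: path_weight_sub pm1.
elim: pm2 => [|u v pu _ IH]; first by rewrite add0r; apply: path_weight_sub pm3.
by rewrite -addrA; apply: (path_weight_cat (mem_head q X)) IH; apply: path_weight_sub pu.
Qed.

Lemma semilinear_path_weight X a b : semilinear (path_weight X a b).
Proof.
elim: X a b => [|q X IH] a b.
  have nilE m : path_weight [::] a b m <-> ok a b /\ m = wt b.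
    split=> [[{}a {}b ab|{}a {}b c {}m _]|[ab ->]] //.
    exact: path_weight_one.
  case: (pselect (ok a b)) => ab.
    by apply: semilinear_ext (semilinear_point (wt b)) => x; rewrite nilE; split=> [|[]].
  by apply: semilinear_ext (semilinear_empty M) => x; rewrite nilE; split=> // -[].
apply: semilinear_ext (semilinear_union (IH a b)
  (semilinear_sum (IH a q) (semilinear_sum (semilinear_star (IH q q)) (IH q b)))) => x.
by rewrite path_weight_kleene.
Qed.

End PathWeights.

(** * Closures of octagonal relations *)

Definition chain (T : Type) (R : T -> T -> Prop) (n : nat) (x y : T) : Prop :=
  exists r : nat -> T, [/\ r 0%N = x, r n = y & forall i, (i < n)%N -> R (r i) (r i.+1)].

Lemma clos_refl_trans_chain (T : Type) (R : T -> T -> Prop) x y :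
  clos_refl_trans T R x y <-> exists n, chain R n x y.
Proof.
split.
  elim=> [{}x {}y xy|{}x|{}x {}y z _ [n [r [r0 rn rR]]] _ [m [s [s0 sm sR]]]].
  - by exists 1%N, (fun i => if i is 0%N then x else y); split=> // -[].
  - by exists 0%N, (fun=> x).
  - exists (n + m)%N, (fun i => if (i <= n)%N then r i else s (i - n)%N); split=> //.
      case: m => [|m] in sm sR *; first by rewrite addn0 leqnn rn -sm s0.
      by rewrite leqNgt -addSnnS ltn_addr ?addSnnS ?addKn.
    move=> i lt_i; have [lt_in|] := ltnP i n; first by rewrite ltnW //; apply: rR.
    rewrite leq_eqVlt => /predU1P[eq_ni|lt_ni].
      have := sR 0%N; rewrite -eq_ni leqnn subSnn rn s0; apply.
      by move: lt_i; rewrite -eq_ni; lia.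
    by rewrite leqNgt lt_ni /= subSn ?(ltnW lt_ni) //; apply: sR; lia.
case=> n [r [<- <- rR]]; elim: n rR => [|n IH] rR; first exact: rt_refl.
apply: rt_trans (IH _) _ => [i lt_in|]; first by apply: rR; apply: ltnW.
by apply: rt_step; apply: rR.
Qed.

Section WordWeights.
Variables (T : finType) (ok : T -> T -> Prop) (M : zmodType) (wt : T -> M).

(** Words count all their letters and may consist of one letter, whereas [path_weight] omits the
    first vertex and has at least one edge. *)
Definition word_weight (a b : T) (m : M) : Prop :=
  (a = b /\ m = wt a) \/
  (exists x y, [/\ x = wt a, path_weight ok wt (enum T) a b y & m = x + y]).

Lemma word_weight_rcons a b c m :
  word_weight a b m -> ok b c -> word_weight a c (m + wt c).
Proof.
move=> [[-> ->]|[x [y [-> py ->]]]] bc; right.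
  by exists (wt b), (wt c); split=> //; apply: path_weight_one.
exists (wt a), (y + wt c); rewrite addrA; split=> //.
apply: (path_weight_cat (c := b)) => //; first by rewrite mem_enum.
exact: path_weight_one.
Qed.

Lemma word_weight_sum (l : nat -> T) n :
  (forall i, (i < n)%N -> ok (l i) (l i.+1)) ->
  word_weight (l 0%N) (l n) (\sum_(i < n.+1) wt (l i)).
Proof.
elim: n => [|n IH] okl; first by left; rewrite big_ord1.
rewrite big_ord_recr /=; apply: word_weight_rcons (okl n _) => //.
by apply: IH => i lt_in; apply: okl; apply: ltnW.
Qed.

Lemma semilinear_word_weight a b : semilinear (word_weight a b).
Proof.
apply: semilinear_union; last first.
  apply: semilinear_sum; first exact: semilinear_point.
  exact: semilinear_path_weight.
case: (pselect (a = b)) => ab.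
  by apply: semilinear_ext (semilinear_point (wt a)) => x; split=> [|[]].
by apply: semilinear_ext (semilinear_empty M) => x; split=> // -[].
Qed.

End WordWeights.

(** * Refutations of runs of an octagonal relation *)

Section OctagonalClosure.
Variables (N : nat) (C : oct_constraint N).

Notation var := ('I_N + 'I_N)%type.
Notation state := ('I_N -> int).

Definition atom_src (a : oct_atom var) : literal var :=
  match a with OctSub u _ _ | OctAdd u _ _ => (true, u) | OctOpp u _ _ => (false, u) end.
Definition atom_tgt (a : oct_atom var) : literal var :=
  match a with OctSub _ v _ | OctOpp _ v _ => (true, v) | OctAdd _ v _ => (false, v) end.
Definition atom_wt (a : oct_atom var) : int :=
  match a with OctSub _ _ c | OctAdd _ _ c | OctOpp _ _ c => c end.

Lemma oct_atom_slope e a :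
  oct_atom_holds e a = (lit_val e (atom_src a) - lit_val e (atom_tgt a) <= atom_wt a).
Proof. by case: a => u v c; rewrite /lit_val /= ?opprK. Qed.

(* Each atom yields an edge between literals and its contrapositive. *)
Definition edge : finType := ('I_(size C) * bool)%type.
Definition edge_atom (e : edge) : oct_atom var := tnth (in_tuple C) e.1.
Definition edge_src (e : edge) : literal var :=
  if e.2 then lneg (atom_tgt (edge_atom e)) else atom_src (edge_atom e).
Definition edge_tgt (e : edge) : literal var :=
  if e.2 then lneg (atom_src (edge_atom e)) else atom_tgt (edge_atom e).
Definition edge_wt (e : edge) : int := atom_wt (edge_atom e).

Lemma oct_relation_edges x x' : oct_relation C x x' <->
  forall e, slope edge_src edge_tgt (join (env x) (env x')) e <= edge_wt e.
Proof.
rewrite /oct_relation /slope; pose c := in_tuple C.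
split=> [/(@all_tnthP _ _ _ c) h [j b]|h].
  have := h j; rewrite oct_atom_slope /edge_src /edge_tgt /edge_wt.
  by case: b => //=; rewrite !lit_val_lneg opprK addrC.
by apply/(@all_tnthP _ _ _ c) => j; rewrite oct_atom_slope; have := h (j, false).
Qed.

(** The left-hand side of the sum of the constraints in [A]. By linearity it splits into a form on
    the unprimed variables, [entry], and one on the primed variables, [exit]. *)
Definition total (A : {set edge}) (y : var -> int) : int :=
  \sum_(e in A) slope edge_src edge_tgt y e.
Definition entry (A : {set edge}) (y : state) : int := total A (join y (fun=> 0)).
Definition exit (A : {set edge}) (y : state) : int := total A (join (fun=> 0) y).

Lemma total_join A y y' : total A (join y y') = entry A y + exit A y'.
Proof.
rewrite /entry /exit /total -big_split /=; apply: eq_bigr => e _.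
have lvD a : lit_val (join y y') a =
    lit_val (join y (fun=> 0)) a + lit_val (join (fun=> 0) y') a.
  by case: a => -[] [] i; rewrite /lit_val /=; lia.
by rewrite /slope !lvD opprD addrACA.
Qed.

Lemma total0 A y : (forall u, y u = 0) -> total A y = 0.
Proof.
by move=> y0; rewrite /total big1 // => e _; rewrite /slope /lit_val !y0 oppr0 !if_same subrr.
Qed.

Lemma entry0 A y : (forall i, y i = 0) -> entry A y = 0.
Proof. by move=> y0; apply: total0 => -[]. Qed.

Lemma exit0 A y : (forall i, y i = 0) -> exit A y = 0.
Proof. by move=> y0; apply: total0 => -[]. Qed.

(* A letter is the part of a pair of certificates lying in one copy of the
   constraints. Consecutive letters must cancel, up to an even form, on the
   intermediate variables, and the two even forms must be opposite. *)
Definition letter : finType := ({set edge} * {set edge})%type.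

Definition adjacent (l l' : letter) : Prop :=
  exists h : state -> int, forall y,
    exit l.1 y + entry l'.1 y = 2 * h y /\ exit l.2 y + entry l'.2 y = - (2 * h y).

Definition o0 : 'I_3 := @Ordinal 3 0 isT.
Definition o1 : 'I_3 := @Ordinal 3 1 isT.
Definition o2 : 'I_3 := @Ordinal 3 2 isT.

Definition vec3 (a b c : int) : 'cV[int]_3 := \col_i nth 0 [:: a; b; c] i.

Lemma vec3E (m : 'cV[int]_3) : m = vec3 (m o0 ord0) (m o1 ord0) (m o2 ord0).
Proof.
by apply/matrixP => -[[|[|[|//]]] lt] j; rewrite ord1 mxE /=; congr (m _ _); apply: val_inj.
Qed.

Lemma add_colE (d : nat) (u v : 'cV[int]_d) i j : (u + v) i j = u i j + v i j :> int.
Proof. by rewrite mxE. Qed.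

Definition cost (A : {set edge}) : int := \sum_(e in A) edge_wt e.

Lemma vec3_coord a b c :
  (vec3 a b c o0 ord0 = a) * (vec3 a b c o1 ord0 = b) * (vec3 a b c o2 ord0 = c).
Proof. by rewrite !mxE. Qed.

(** The first coordinate counts the copies of the relation, that is, the length of the run; the
    others accumulate the costs of the two halves of the certificate. *)
Definition letter_wt (l : letter) : 'cV[int]_3 :=
  vec3 1 (cost l.1) (cost l.2).

(** A certificate read as a word of [n] letters. The end states are constants, so their
    contributions are moved to the bounds. The length is an integer so that a formula can quantify
    over it. *)
Definition refuted (n : int) (x x' : state) : Prop :=
  exists a b : letter, exists w1 w2 p q : int,
  [/\ word_weight adjacent letter_wt a b (vec3 n w1 w2),
      w1 - entry a.1 x - exit b.1 x' <= 2 * p + 1,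
      w2 - entry a.2 x - exit b.2 x' <= 2 * q + 1 &
      p + q <= -1].

Lemma letter_wtE l : (letter_wt l o0 ord0 = 1) *
  (letter_wt l o1 ord0 = cost l.1) *
  (letter_wt l o2 ord0 = cost l.2).
Proof. by rewrite !vec3_coord. Qed.

Lemma total_le A x x' : oct_relation C x x' ->
  total A (join (env x) (env x')) <= cost A.
Proof. by move/oct_relation_edges => h; apply: ler_sum. Qed.

(** The witness [z] accumulates the values of the forms [h] of [adjacent] at the inner states of the
    run. It occurs with opposite signs in the two inequalities, so a refutation would force [z <= p]
    and [- z <= q]. *)
Definition sound_word (a b : letter) (m : 'cV[int]_3) : Prop :=
  exists2 k : nat, m o0 ord0 = k & forall r : nat -> valuation N,
    (forall i, (i < k)%N -> oct_relation C (r i) (r i.+1)) -> exists z : int,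
    entry a.1 (env (r 0%N)) + exit b.1 (env (r k)) + 2 * z <= m o1 ord0 /\
    entry a.2 (env (r 0%N)) + exit b.2 (env (r k)) - 2 * z <= m o2 ord0.

Lemma sound_word1 a : sound_word a a (letter_wt a).
Proof.
exists 1%N => [|r rR]; first by rewrite letter_wtE.
have R0 := rR 0%N isT; exists 0; rewrite !letter_wtE -!total_join mulr0 subr0 addr0.
by split; apply: total_le.
Qed.

Lemma sound_word_cons a c b m :
  adjacent a c -> sound_word c b m -> sound_word a b (letter_wt a + m).
Proof.
case=> h ac [k mk sw]; exists k.+1 => [|r rR]; first by rewrite add_colE letter_wtE mk; lia.
have [i lt_ik|z [le1 le2]] := sw (fun i => r i.+1); first by apply: rR.
have R0 := rR 0%N isT; have [ac1 ac2] := ac (env (r 1%N)).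
have := total_le a.1 R0; have := total_le a.2 R0; rewrite !total_join => la2 la1.
exists (z + h (env (r 1%N))); rewrite !add_colE !letter_wtE.
move: ac1 ac2 la1 la2 le1 le2 => /= *; split; lia.
Qed.

Lemma word_weight_sound a b m :
  word_weight adjacent letter_wt a b m -> sound_word a b m.
Proof.
case=> [[-> ->]|[x [y [-> py ->]]]]; first exact: sound_word1.
elim: py => [{}a {}b ab|{}a {}b c {}m ac _ _ IH].
  by apply: sound_word_cons ab _; apply: sound_word1.
exact: sound_word_cons ac IH.
Qed.

Lemma refuted_sound (n : nat) x x' :
  refuted n (env x) (env x') -> ~ chain (oct_relation C) n x x'.
Proof.
case=> a [b [w1 [w2 [p [q [/word_weight_sound[k] ]]]]]].
rewrite vec3_coord => -[<-] sw le1 le2 lpq [r [r0 rn rR]].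
by have [z] := sw r rR; rewrite !vec3_coord r0 rn; lia.
Qed.

(** * Every missing run has a refutation *)

Section Completeness.
Variables (n : nat) (x x' : valuation N).

(* The constraints of [n.+1] consecutive copies, together with the equations
   fixing the first and last states. *)
Definition unfolding_var : finType := ('I_n.+2 * 'I_N)%type.
Definition unfolding_edge : finType := (('I_n.+1 * edge) + (bool * bool * 'I_N))%type.

Definition at_level (i : nat) (a : literal var) : literal unfolding_var :=
  (a.1, match a.2 with inl k => (inord i, k) | inr k => (inord i.+1, k) end).

Definition side_level (s : bool) : nat := if s then n.+1 else 0%N.
Definition side_state (s : bool) : state := env (if s then x' else x).

Definition unf_src (f : unfolding_edge) : literal unfolding_var :=
  match f with
  | inl (i, e) => at_level i (edge_src e)
  | inr (s, sg, k) => (sg, (inord (side_level s), k))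
  end.
Definition unf_tgt (f : unfolding_edge) : literal unfolding_var :=
  match f with
  | inl (i, e) => at_level i (edge_tgt e)
  | inr (s, sg, k) => (~~ sg, (inord (side_level s), k))
  end.
(** A bound [x <= c] on an end variable is written between a literal and its negation, as
    [x - (- x) <= 2 c]; hence the factor 2. *)
Definition unf_wt (f : unfolding_edge) : int :=
  match f with
  | inl (i, e) => edge_wt e
  | inr (s, sg, k) => 2 * (if sg then side_state s k else - side_state s k)
  end.

Lemma unf_skew f : exists f',
  [/\ unf_src f' = lneg (unf_tgt f), unf_tgt f' = lneg (unf_src f) & unf_wt f' = unf_wt f].
Proof.
case: f => [[i [j b]]|[[s sg] k]]; last by exists (inr (s, sg, k)); rewrite /lneg /= negbK.
exists (inl (i, (j, ~~ b))); rewrite /unf_src /unf_tgt /unf_wt /edge_src /edge_tgt /edge_wt.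
by case: b; split=> //=; rewrite /at_level /lneg /edge_atom /= ?negbK.
Qed.

Definition extend (y : nat -> state) (v : unfolding_var) : int := y v.1 v.2.

Lemma slope_level y (i : 'I_n.+1) e :
  slope unf_src unf_tgt (extend y) (inl (i, e)) =
  slope edge_src edge_tgt (join (y i) (y i.+1)) e.
Proof.
have lv a : lit_val (extend y) (at_level i a) = lit_val (join (y i) (y i.+1)) a.
  case: a => sg [] k; rewrite /lit_val /extend /at_level /= inordK //.
    by rewrite ltnS ltnW.
  by rewrite ltnS.
by rewrite /slope /= !lv.
Qed.

Lemma slope_side y s sg k : slope unf_src unf_tgt (extend y) (inr (s, sg, k)) =
  2 * (if sg then y (side_level s) k else - y (side_level s) k).
Proof.
by rewrite /slope /lit_val /extend /= inordK; [case: sg | case: s]; rewrite //=; lia.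
Qed.

Definition slice (A : {set unfolding_edge}) (i : nat) : {set edge} :=
  [set e | inl (inord i, e) \in A]%SET.

Lemma sum_slices (A : {set unfolding_edge}) (G : unfolding_edge -> int) :
  \sum_(f in A) G f =
  \sum_(i < n.+1) \sum_(e in slice A i) G (inl (i, e)) + \sum_(s | inr s \in A) G (inr s).
Proof.
rewrite big_sumType /=; congr (_ + _).
rewrite (eq_bigr (fun i : 'I_n.+1 => \sum_(e | inl (i, e) \in A) G (inl (i, e)))); last first.
  by move=> i _; apply: eq_bigl => e; rewrite inE inord_val.
rewrite pair_big_dep /=; apply: eq_big; last by case.
by case.
Qed.

Lemma sum_slope (A : {set unfolding_edge}) y :
  \sum_(f in A) slope unf_src unf_tgt (extend y) f =
  \sum_(i < n.+1) entry (slice A i) (y i) + \sum_(i < n.+1) exit (slice A i) (y i.+1) +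
  \sum_(s | inr s \in A) slope unf_src unf_tgt (extend y) (inr s).
Proof.
rewrite sum_slices -big_split; congr (_ + _); apply: eq_bigr => i _ /=.
by rewrite -total_join; apply: eq_bigr => e _; rewrite slope_level.
Qed.

Definition side_cost (A : {set unfolding_edge}) : int :=
  \sum_(s | inr s \in A) unf_wt (inr s).
Definition level_cost (A : {set unfolding_edge}) : int := \sum_(i < n.+1) cost (slice A i).

(** An integer solution of the unfolded system is a run. A certificate is sliced by level into a
    word, and its identities, which hold for all assignments, are evaluated at assignments supported
    on few levels: on the two end levels they give the bounds, on one inner level they give
    adjacency. *)
Lemma refuted_complete : chain (oct_relation C) n.+1 x x' \/ refuted n.+1 (env x) (env x').
Proof.
have [[X solX]|[A [B [g [p [q [gA gB leA leB lpq]]]]]]] := integer_farkas unf_skew.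
  left; exists (fun i => \col_k X (inord i, k)).
  have side s : \col_k X (inord (side_level s), k) = if s then x' else x.
    apply/matrixP => k j; have -> : j = ord0 by apply: ord1.
    rewrite mxE.
    have := solX (inr (s, true, k)); have := solX (inr (s, false, k)).
    by rewrite /slope /lit_val /unf_wt /side_state /env /=; lia.
  split; [exact: (side false) | exact: (side true) | move=> i lt_i].
  apply/oct_relation_edges => e; have := solX (inl (inord i, e)).
  rewrite /slope /=; have lv a : lit_val X (at_level (inord i : 'I_n.+1) a) =
      lit_val (join (env (\col_k X (inord i, k))) (env (\col_k X (inord i.+1, k)))) a.
    by case: a => sg [] k; rewrite /lit_val /at_level /env /= mxE inordK.
  by rewrite !lv.
right; pose l i : letter := (slice A i, slice B i).
exists (l 0%N), (l n).
(* This assignment keeps only the contributions of the two ends, and gives each edge that fixes an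
   end variable a slope equal to its weight. *)
pose y (i : nat) : state := if i == 0%N then env x else if i == n.+1 then env x' else fun=> 0.
(* For [A], [2 g] at [y] is the contribution of the ends plus [side_cost A]. Subtracting it from the
   bound [2 p + 1] on the full weight removes the side cost and shifts [p] by the value of [g]; for
   [B] the sign is opposite, so [p + q] is unchanged. *)
exists (level_cost A), (level_cost B), (p - g (extend y)), (q + g (extend y)).
have sideE (D : {set unfolding_edge}) :
    \sum_(s | inr s \in D) slope unf_src unf_tgt (extend y) (inr s) =
    side_cost D.
  apply: eq_bigr => -[[s sg] k] _; rewrite slope_side /=.
  by rewrite /y /side_state; case: s; rewrite /= ?eqxx.
have slopeE (D : {set unfolding_edge}) : \sum_(f in D) slope unf_src unf_tgt (extend y) f =
    entry (slice D 0) (env x) + exit (slice D n) (env x') + side_cost D.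
  rewrite sum_slope sideE; congr (_ + _ + _).
    rewrite big_ord_recl big1 ?addr0 => [|i _]; first by rewrite /y.
    by apply: entry0 => k; rewrite /y /= /bump leq0n add1n eqSS (ltn_eqF (ltn_ord i)).
  rewrite big_ord_recr /= big1 ?add0r => [|i _]; first by rewrite /y /= eqxx.
  by apply: exit0 => k; rewrite /y /= eqSS (ltn_eqF (ltn_ord i)).
have wtE (D : {set unfolding_edge}) : \sum_(f in D) unf_wt f =
    level_cost D + side_cost D.
  by rewrite sum_slices.
split; last by lia.
- have -> : vec3 n.+1 (level_cost A) (level_cost B) = \sum_(i < n.+1) letter_wt (l i).
    rewrite [RHS]vec3E !summxE; congr vec3.
    - by rewrite (eq_bigr (fun=> 1)) ?sumr_const ?card_ord ?natz // => i _; rewrite mxE.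
    - by apply: eq_bigr => i _; rewrite mxE.
    - by apply: eq_bigr => i _; rewrite mxE.
  apply: word_weight_sum => i lt_in.
  (* Since [i < n], level [i.+1] is neither end, so the edges fixing the end variables have slope
     zero at [delta z]. *)
  pose delta (z : state) (j : nat) : state := if j == i.+1 then z else fun=> 0.
  exists (fun z => g (extend (delta z))) => z.
  suff E (D : {set unfolding_edge}) :
      \sum_(f in D) slope unf_src unf_tgt (extend (delta z)) f =
      exit (slice D i) z + entry (slice D i.+1) z by split; rewrite -?gB -?gA !E.
  have lt_i1 : (i.+1 < n.+1)%N by [].
  have lt_i : (i < n.+1)%N by apply: ltnW.
  rewrite sum_slope [X in _ + X]big1 ?addr0 => [|[[s sg] k] _]; last first.
    rewrite slope_side /delta; have -> : (side_level s == i.+1) = false.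
      by case: (s) => //=; rewrite eqSS gtn_eqF.
    by case: sg; lia.
  rewrite addrC; congr (_ + _).
    rewrite (bigD1 (Ordinal lt_i)) //= big1 ?addr0 => [|j ji]; first by rewrite /delta eqxx.
    by apply: exit0 => k; rewrite /delta eqSS (negbTE (ji : val j != i)).
  rewrite (bigD1 (Ordinal lt_i1)) //= big1 ?addr0 => [|j ji]; first by rewrite /delta eqxx.
  by apply: entry0 => k; rewrite /delta (negbTE (ji : val j != i.+1)).
- by have := gA (extend y); rewrite slopeE; move: leA; rewrite wtE /=; lia.
- by have := gB (extend y); rewrite slopeE; move: leB; rewrite wtE /=; lia.
Qed.

End Completeness.

Lemma affine_total (V : Type) A (t : var -> (V -> int) -> int) :
  (forall u, affine (t u)) -> affine (fun e => total A (fun u => t u e)).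
Proof.
move=> at_; apply: affine_sum => i.
have lv a : affine (fun e => lit_val (fun u => t u e) a).
  by case: a => -[] u; rewrite /lit_val //=; apply: affine_opp.
exact: affine_sub.
Qed.

Lemma affine_entry (V : Type) A (t : 'I_N -> (V -> int) -> int) :
  (forall i, affine (t i)) -> affine (fun e => entry A (fun i => t i e)).
Proof.
move=> at_; have [|tm etm] := @affine_total V A (fun u e => join (fun i => t i e) (fun=> 0) u).
  by case=> i //=; apply: affine_cst.
by exists tm => e; rewrite etm.
Qed.

Lemma affine_exit (V : Type) A (t : 'I_N -> (V -> int) -> int) :
  (forall i, affine (t i)) -> affine (fun e => exit A (fun i => t i e)).
Proof.
move=> at_; have [|tm etm] := @affine_total V A (fun u e => join (fun=> 0) (fun i => t i e) u).
  by case=> i //=; apply: affine_cst.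
by exists tm => e; rewrite etm.
Qed.

(** There are finitely many letters and word weights are semilinear, so only four integer
    quantifiers over definable conditions remain. *)
Lemma definable_refuted (V : Type) (n : (V -> int) -> int) (t t' : 'I_N -> (V -> int) -> int) :
  affine n -> (forall i, affine (t i)) -> (forall i, affine (t' i)) ->
  definable (fun e => refuted (n e) (fun i => t i e) (fun i => t' i e)).
Proof.
move=> an at_ at'.
pose body (a b : letter) e w1 w2 p q :=
  word_weight adjacent letter_wt a b (vec3 (n e) w1 w2) /\
  (w1 - entry a.1 (fun i => t i e) - exit b.1 (fun i => t' i e) <= 2 * p + 1 /\
  (w2 - entry a.2 (fun i => t i e) - exit b.2 (fun i => t' i e) <= 2 * q + 1 /\
  p + q <= -1)).
have ext e : (exists a b w1 w2 p q, body a b e w1 w2 p q) <->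
    refuted (n e) (fun i => t i e) (fun i => t' i e).
  split=> -[a [b [w1 [w2 [p [q]]]]]]; rewrite /body.
    by case=> ? [? []]; exists a, b, w1, w2, p, q.
  by case=> *; exists a, b, w1, w2, p, q.
apply: definable_ext ext _; apply: definable_exists_fin => a.
apply: definable_exists_fin => b; do 4!apply: definable_exists_int.
have ren W (g : V -> W) (u : (V -> int) -> int) : affine u -> affine (fun e => u (e \o g)).
  exact: affine_rename.
have aentry W (g : V -> W) A : affine (fun e => entry A (fun i => t i (e \o g))).
  by apply: affine_entry => i; apply: ren.
have aexit W (g : V -> W) A : affine (fun e => exit A (fun i => t' i (e \o g))).
  by apply: affine_exit => i; apply: ren.
pose g (v : V) : V + 'I_1 + 'I_1 + 'I_1 + 'I_1 := inl (inl (inl (inl v))).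
have half v : affine (fun e : V + 'I_1 + 'I_1 + 'I_1 + 'I_1 -> int => 2 * e v + 1).
  by apply: affine_add (affine_cst _ _); apply: affine_scale; apply: affine_var.
apply: definable_and.
  apply: (definable_semilinear (semilinear_word_weight _ _ _ _)) => -[[|[|[|//]]] lt].
  - by have [tm etm] := ren _ g _ an; exists tm => e; rewrite etm mxE.
  - by exists (Var (inl (inl (inl (inr ord0))))) => e; rewrite mxE.
  - by exists (Var (inl (inl (inr ord0)))) => e; rewrite mxE.
apply: definable_and.
  apply: definable_le (half (inl (inr ord0))).
  apply: affine_sub (aexit _ g b.1); apply: affine_sub (aentry _ g a.1).
  exact: (affine_var (inl (inl (inl (inr ord0))))).
apply: definable_and.
  apply: definable_le (half (inr ord0)).
  apply: affine_sub (aexit _ g b.2); apply: affine_sub (aentry _ g a.2).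
  exact: (affine_var (inl (inl (inr ord0)))).
apply: definable_le (affine_cst _ _).
by apply: affine_add; [exact: (affine_var (inl (inr ord0))) | exact: (affine_var (inr ord0))].
Qed.

(** The closure is the identity together with the runs of each length [n >= 1], and such a run
    exists exactly when nothing refutes it. Length zero is separate because the unfolding has at
    least one copy. *)
Lemma clos_octagonal_definable : exists T : relform N,
  defines T (clos_refl_trans _ (oct_relation C)).
Proof.
pose src (e : var -> int) : state := fun i => e (inl i).
pose tgt (e : var -> int) : state := fun i => e (inr i).
pose S e := (forall i, tgt e i = src e i) \/
  exists n : int, 1 <= n /\ ~ refuted n (src e) (tgt e).
have [T eT] : definable S.
  apply: definable_or.
    by apply: definable_forall_fin => i; apply: definable_eq; apply: affine_var.
  apply: definable_exists_int; apply: definable_and.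
    exact: definable_le (affine_cst _ _) (affine_var _).
  apply/definable_not/definable_refuted => [|i|i]; first exact: affine_var.
    exact: (affine_var (inl (inl i))).
  exact: (affine_var (inl (inr i))).
exists T => x x'; rewrite /relation_of eT clos_refl_trans_chain; split.
  case=> [xx'|[[[|n]|n] [n0 nref]]] //.
    exists 0%N, (fun=> x); split=> //; apply/matrixP => i j.
    by have -> : j = ord0 := ord1 j; rewrite -[LHS]xx'.
  by exists n.+1; case: (refuted_complete n x x') => // /nref.
case=> -[|n] ch; first by left; case: ch => r [<- <- _].
by right; exists n.+1%:Z; split=> // /refuted_sound; apply.
Qed.

End OctagonalClosure.

(** * Closures of finite monoid affine relations *)

(** Without a repetition the powers would be pairwise distinct, hence infinite in number. *)
Lemma finite_powers_period (N : nat) (A : 'M[int]_N) :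
  finite_set (range (fun i : nat => A ^+ i)) ->
  exists m p : nat, A ^+ (m + p.+1) = A ^+ m.
Proof.
move=> fin; apply: contrapT => noper; apply: infinite_nat.
rewrite -(preimage_range (fun i : nat => A ^+ i)); apply: finite_preimage fin.
move=> i j _ _ eq_ij.
have [lt|lt|//] := ltngtP i j; case: noper.
  by exists i, (j - i).-1; rewrite prednK ?subn_gt0 // subnKC // ltnW.
by exists j, (i - j).-1; rewrite prednK ?subn_gt0 // subnKC // ltnW.
Qed.

Section AffineIteration.
Variables (N : nat) (A : 'M[int]_N) (b : 'cV[int]_N) (m p : nat).
Hypothesis period : A ^+ (m + p.+1) = A ^+ m.

Definition affine_map (v : 'cV[int]_N) : 'cV[int]_N := A *m v + b.
Notation F := affine_map.

Lemma iter_affine_sub n u v : iter n F u - iter n F v = A ^+ n *m (u - v).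
Proof.
elim: n => [|n IH]; first by rewrite expr0 mul1mx.
by rewrite /= /affine_map opprD addrACA subrr addr0 -mulmxBr IH exprS mulmxA.
Qed.

Lemma periodic_power j : (m <= j)%N -> A ^+ (j + p.+1) = A ^+ j.
Proof. by move/subnK <-; rewrite -addnA exprD period -exprD. Qed.

(** Once [j >= m], one more period translates the [j]-th iterate by a vector independent of the
    starting point, which may therefore be computed at 0. *)
Definition drift j : 'cV[int]_N := iter (j + p.+1) F 0 - iter j F 0.

Lemma iter_affine_drift j v : (m <= j)%N -> iter (j + p.+1) F v = iter j F v + drift j.
Proof.
move=> mj; have := iter_affine_sub (j + p.+1) v 0; rewrite periodic_power //.
rewrite -(iter_affine_sub j v 0) /drift => /(canRL (subrK _)) ->.
by rewrite addrA addrAC.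
Qed.

Lemma driftD j k : (m <= j)%N -> drift (j + k * p.+1) = drift j.
Proof.
have driftE i : drift i = A ^+ i *m iter p.+1 F 0.
  by rewrite /drift iterD iter_affine_sub subr0.
move=> mj; rewrite !driftE; congr (_ *m _).
elim: k => [|k IH]; first by rewrite mul0n addn0.
by rewrite mulSnr addnA periodic_power ?IH // (leq_trans mj) ?leq_addr.
Qed.

Lemma iter_affine_periodic j k v :
  (m <= j)%N -> iter (j + k * p.+1) F v = iter j F v + k%:Z *: drift j.
Proof.
move=> mj; elim: k => [|k IH]; first by rewrite mul0n addn0 scale0r addr0.
rewrite mulSnr addnA iter_affine_drift; last by rewrite (leq_trans mj) ?leq_addr.
by rewrite driftD // IH -addrA (intS k) scalerDl scale1r [drift j + _]addrC.
Qed.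

Lemma affine_vec_iter (V : Type) (v : (V -> int) -> 'cV[int]_N) n :
  affine_vec v -> affine_vec (fun e => iter n F (v e)).
Proof.
move=> av; elim: n => [//|n IH] i.
have a1 : affine (fun e => \sum_k A i k * iter n F (v e) k ord0).
  by apply: affine_sum => k; apply: affine_scale.
have [tm etm] := affine_add a1 (affine_cst V (b i ord0)).
by exists tm => e; rewrite etm /= /affine_map !mxE.
Qed.

(** The exponent is itself a term. It is either one of finitely many values below [m], or of the
    form [m + r + (p + 1) k] for one of finitely many [r]; in the second case the iterate is affine
    in [k] and the environment. *)
Lemma definable_iter (V : Type) (n : (V -> int) -> int) (v : (V -> int) -> 'cV[int]_N)
    (S : ('I_N + V -> int) -> Prop) :
  affine n -> affine_vec v -> definable S ->
  definable (fun e => 0 <= n e /\ S (join (env (iter `|n e|%N F (v e))) e)).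
Proof.
move=> an av dS.
have dSt (W : Type) (g : V -> W) (t : (W -> int) -> 'cV[int]_N) :
    affine_vec t -> definable (fun e => S (join (env (t e)) (e \o g))).
  move=> at_; have := @definable_subst _ W S
    (fun u e => join (env (t e)) (e \o g) u) dS.
  apply=> -[i|u] /=; [exact: at_ | exact: affine_var].
pose small e := exists j : 'I_m, n e = j%:Z /\ S (join (env (iter j F (v e))) e).
pose large e := exists r : 'I_p.+1, exists k : int,
  0 <= k /\ (n e = (m + r)%:Z + p.+1%:Z * k /\
  S (join (env (iter (m + r) F (v e) + k *: drift (m + r))) e)).
have dsmall : definable small.
  apply: definable_exists_fin => j; apply: definable_and.
    by apply: definable_eq => //; apply: affine_cst.
  exact: (dSt V id _ (affine_vec_iter j av)).
have dlarge : definable large.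
  apply: definable_exists_fin => r; apply: definable_exists_int.
  apply: definable_and; first exact: definable_le (affine_cst _ _) (affine_var _).
  apply: definable_and.
    apply: definable_eq; first exact: affine_rename.
    by apply: affine_add (affine_cst _ _) (affine_scale _ (affine_var _)).
  apply: (dSt _ (@inl V 'I_1)) => i.
  have := affine_add (affine_rename (@inl V 'I_1) (affine_vec_iter (m + r) av i))
    (affine_scale (drift (m + r) i ord0) (affine_var (inr ord0))).
  by case=> tm etm; exists tm => e; rewrite etm !mxE mulrC.
apply: definable_ext (definable_or dsmall dlarge) => e; split.
  case=> [[j [-> Sj]]|[r [[k|k] [k0 [-> Sk]]]]] //.
  rewrite -iter_affine_periodic ?leq_addr // in Sk.
  by have -> : (m + r)%:Z + p.+1%:Z * k = (m + r + k * p.+1)%N by lia.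
case en: (n e) => [i|i] [] // _ Si.
have [lt_im|le_mi] := ltnP i m; first by left; exists (Ordinal lt_im).
right; have lt_r : ((i - m) %% p.+1 < p.+1)%N by rewrite ltn_mod.
have ei : i = (m + Ordinal lt_r + (i - m) %/ p.+1 * p.+1)%N.
  by rewrite /= -addnA addnC [X in (X + m)%N]addnC -divn_eq subnK.
exists (Ordinal lt_r), ((i - m) %/ p.+1)%N%:Z; split=> //; split.
  by rewrite en {1}ei; lia.
by rewrite -iter_affine_periodic ?leq_addr // -ei.
Qed.

Lemma chain_affine (R : valuation N -> valuation N -> Prop) (g : valuation N -> Prop) n x x' :
  (forall u v, R u v <-> v = F u /\ g u) ->
  chain R n x x' <-> iter n F x = x' /\ forall i, (i < n)%N -> g (iter i F x).
Proof.
move=> ER; split=> [[r [<- <- rR]]|[<- gi]].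
  have it i : (i <= n)%N -> r i = iter i F (r 0%N).
    by elim: i => // i IH lt_in; have /ER[-> _] := rR i lt_in; rewrite IH ?(ltnW lt_in).
  split=> [|i lt_in]; first by rewrite -it.
  by have /ER[_] := rR i lt_in; rewrite it // ltnW.
by exists (fun i => iter i F x); split=> // i lt_in; apply/ER; split=> //; apply: gi.
Qed.

End AffineIteration.

Lemma clos_finite_monoid_affine_definable (N : nat) (R : valuation N -> valuation N -> Prop) :
  finite_monoid_affine R -> exists T : relform N, defines T (clos_refl_trans _ R).
Proof.
case=> A [b [g [_ /finite_powers_period[m [p per]] ER]]].
pose x (e : 'I_N + 'I_N -> int) : 'cV[int]_N := \col_i e (inl i).
pose F := affine_map A b.
(* The relation is a partial function, so the closure holds when some iterate is the target and the
   guard fails at no earlier iterate. *)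
pose S e := exists n : int, (0 <= n /\ forall i, iter `|n|%N F (x e) i ord0 = e (inr i)) /\
  ~ exists i : int, (0 <= i /\ ~ holds (env (iter `|i|%N F (x e))) g) /\ i < n.
have ax (W : Type) (h : 'I_N + 'I_N -> W) : affine_vec (fun e => x (e \o h)).
  by move=> i; exists (Var (h (inl i))) => e; rewrite mxE.
have [T eT] : definable S.
  apply: definable_exists_int; apply: definable_and.
    apply: (definable_iter (S := fun e => forall i, e (inl i) = e (inr (inl (inr i)))) b per
      (affine_var _) (ax _ inl)).
    by apply: definable_forall_fin => i; apply: definable_eq; apply: affine_var.
  apply: definable_not; apply: definable_exists_int; apply: definable_and; last first.
    have := definable_le (affine_add (affine_var (inr ord0)) (affine_cst _ 1))
      (affine_var (inl (inr ord0) : 'I_N + 'I_N + 'I_1 + 'I_1)).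
    by apply: definable_ext => e /=; rewrite lezD1.
  apply: (definable_iter (S := fun e => ~ holds (e \o inl) g) b per
      (affine_var _) (ax _ (inl \o inl))).
  by apply: definable_not; exists (rename inl g) => e; rewrite holds_rename.
have xE u u' : x (join (env u) (env u')) = u.
  by apply/matrixP => i j; rewrite mxE; have -> : j = ord0 := ord1 j.
exists T => u u'; rewrite /relation_of eT clos_refl_trans_chain /S xE.
have chE n := chain_affine n u u' ER.
split.
  case=> -[n|n] [[n0 en] gn] //; exists n; apply/chE; split.
    by apply/matrixP => i j; have -> : j = ord0 := ord1 j; rewrite -[RHS]en.
  by move=> i lt_in; apply: contrapT => ng; apply: gn; exists i%:Z.
case=> n /chE[en gn]; exists n%:Z; split; first by split=> // i; rewrite -en.
by case=> -[i|i] [[i0 ngi] lt_in] //; apply: ngi; apply: gn.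
Qed.

(** * Octagonal hulls *)

Local Open Scope fset_scope.
Local Open Scope ring_scope.

Section OctagonalHull.
Variables (N : nat) (S : valuation N -> valuation N -> Prop).

Notation var := ('I_N + 'I_N)%type.

Definition atom_value (e : var -> int) (a : oct_atom var) : int :=
  lit_val e (atom_src a) - lit_val e (atom_tgt a).

(** A shape is the left-hand side of an atom; coding the three kinds by two booleans makes the
    shapes a finite type. *)
Definition shape_atom (s : bool * bool * var * var) (c : int) : oct_atom var :=
  let: (b1, b2, u, v) := s in
  if b1 then OctSub u v c else if b2 then OctAdd u v c else OctOpp u v c.

Lemma atom_value_shape e s c : atom_value e (shape_atom s c) = atom_value e (shape_atom s 0).
Proof. by case: s => [[[[] []] u] v]. Qed.

Lemma oct_atom_holds_shape e s c :
  oct_atom_holds e (shape_atom s c) = (atom_value e (shape_atom s 0) <= c).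
Proof.
rewrite oct_atom_slope -/(atom_value _ _) atom_value_shape.
by case: s => [[[[] []] u] v].
Qed.

Lemma atom_shape a : exists s c, a = shape_atom s c.
Proof.
case: a => u v c; first by exists (true, true, u, v), c.
  by exists (false, true, u, v), c.
by exists (false, false, u, v), c.
Qed.

(** For each shape the least bound valid on [S] is kept, if there is a valid one. A point of [S] is
    what bounds the valid constants from below, so the empty relation is treated separately. *)
Lemma octagonal_hull_exists : exists C, octagonal_hull S C.
Proof.
case: (pselect (exists x x', S x x')) => [[x0 [x0' Sx0]]|Sempty]; last first.
  (* With a variable at hand, [x - x <= -1] defines the empty relation; without variables the empty
     conjunction is the only constraint. *)
  case: (pselect (exists i : 'I_N, True)) => [[i _]|noi].
    exists [:: OctSub (inl i) (inl i) (-1)]; split=> [x x' Sx|D _ x x'].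
      by case: Sempty; exists x, x'.
    by rewrite /oct_relation /= subrr.
  exists [::]; split=> // -[|a D] // _ x x' _.
  by case: noi; case: a => -[i|i] _ _; exists i.
suff [C [SC CD]] : exists C : oct_constraint N,
    (forall x x', S x x' -> oct_relation C x x') /\
    forall s, s \in enum {: bool * bool * var * var} -> forall c,
      (forall x x', S x x' -> oct_atom_holds (join (env x) (env x')) (shape_atom s c)) ->
      forall x x', oct_relation C x x' ->
        oct_atom_holds (join (env x) (env x')) (shape_atom s c).
  exists C; split=> //; elim=> [|a D IH] SD x x' Cx //.
  have SaD y y' : S y y' -> oct_atom_holds (join (env y) (env y')) a /\ oct_relation D y y'.
    by move/SD; rewrite /oct_relation /= => /andP.
  rewrite /oct_relation /=; apply/andP; split; last by apply: IH => // y y' /SaD[].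
  have [s [c ea]] := atom_shape a; rewrite ea; apply: CD => //; first by rewrite mem_enum.
  by move=> y y' /SaD[]; rewrite ea.
elim: (enum _) => [|s r [C [SC CD]]]; first by exists [::].
pose bound c := forall x x', S x x' ->
  oct_atom_holds (join (env x) (env x')) (shape_atom s c).
case: (pselect (exists c, bound c)) => [[c0 bnd0]|nbnd].
  have [|c bnd cmin] := @int_bounded_min bound
      (atom_value (join (env x0) (env x0')) (shape_atom s 0)) c0 bnd0.
    by move=> c /(_ _ _ Sx0); rewrite oct_atom_holds_shape.
  exists (shape_atom s c :: C); split=> [x x' Sx|s' s'r c' bnd' x x'].
    by rewrite /oct_relation /= bnd ?SC.
  rewrite /oct_relation /= => /andP[hx Cx]; move: s'r; rewrite inE => /predU1P[es|s'r].
    rewrite es !oct_atom_holds_shape in hx bnd' *; apply: le_trans hx (cmin _ _).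
    by move=> y y' /bnd'.
  exact: CD Cx.
exists C; split=> // s'; rewrite inE => /predU1P[->|s'r] c' bnd'; last exact: CD.
by case: nbnd; exists c'.
Qed.

End OctagonalHull.

Lemma relation_ext (N : nat) (R S : valuation N -> valuation N -> Prop) :
  (forall x y, R x y <-> S x y) -> R = S.
Proof. by move=> RS; apply: funext => x; apply: funext => y; apply/propext. Qed.

Lemma union_of1 (N : nat) (R : relform N) : union_of [fset R] = relation_of R.
Proof.
apply: relation_ext => x y; split=> [[R']|Rxy]; first by rewrite inE => /eqP ->.
by exists R; rewrite ?inE.
Qed.

Lemma loop_closure_exists (N : nat) (S : choiceType) (D : {fset transition N S}) q :
  exists T, loop_closure D q T.
Proof.
rewrite /loop_closure; set L := labels_between D q q.
case: (pselect (L = fset0)) => [L0|Ln0]; first by exists (id_form N); left.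
case: (pselect (single_fma L)) => [sL|nsL].
  have [R eL fR] := sL; have [T eT] := clos_finite_monoid_affine_definable fR.
  exists T; right; split=> //; exists (union_of L); first by left.
  by rewrite eL union_of1.
have [C hC] := octagonal_hull_exists (union_of L).
have [T eT] := clos_octagonal_definable C.
exists T; right; split=> //; exists (oct_relation C) => //.
by right; split=> //; exists C.
Qed.

Lemma relation_of_id (N : nat) x y : relation_of (id_form N) x y <-> x = y.
Proof.
rewrite /relation_of /id_form.
have E (r : seq 'I_N) e :
    holds e (\big[@And _/Top]_(i <- r) Eq (Var (inr i)) (Var (inl i))) <->
    forall i, i \in r -> e (inr i) = e (inl i).
  elim: r => [|i r IH]; first by rewrite big_nil.
  rewrite big_cons /= IH; split=> [[ei h] j|h].
    by rewrite inE => /predU1P[->|/h].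
  by split=> [|j jr]; apply: h; rewrite inE ?eqxx ?jr ?orbT.
rewrite E; split=> [h|-> //]; apply/matrixP => i j.
by have -> : j = ord0 := ord1 j; symmetry; apply: (h i); rewrite mem_index_enum.
Qed.

Definition of_fun (N : nat) (w : 'I_N -> int) : valuation N := \col_i w i.

Lemma env_of_fun (N : nat) (w : 'I_N -> int) : env (of_fun w) = w.
Proof. by apply: funext => i; rewrite /env mxE. Qed.

Lemma relation_of_comp (N : nat) (R S : relform N) x y :
  relation_of (comp_form R S) x y <-> exists z, relation_of R x z /\ relation_of S z y.
Proof.
rewrite /relation_of /comp_form /=.
have E1 (w : 'I_N -> int) : join (join (env x) (env y)) w \o
    join (fun i => inl (inl i)) (fun i => inr i) = join (env x) w by apply: funext => -[].
have E2 (w : 'I_N -> int) : join (join (env x) (env y)) w \o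
    join (fun i => inr i) (fun i => inl (inr i)) = join w (env y) by apply: funext => -[].
split=> [[w]|[z]].
  by rewrite !holds_rename E1 E2 => h; exists (of_fun w); rewrite env_of_fun.
by exists (env z); rewrite !holds_rename E1 E2.
Qed.

Lemma relation_of_comp3 (N : nat) (U T W : relform N) x y :
  relation_of (comp3_form U T W) x y <->
  exists z z', [/\ relation_of U x z, relation_of T z z' & relation_of W z' y].
Proof.
rewrite /relation_of /comp3_form /=.
pose e w w' := join (join (join (env x) (env y)) w) w' : ('I_N + 'I_N) + 'I_N + 'I_N -> int.
have E1 w w' : e w w' \o join (fun i => inl (inl (inl i))) (fun i => inl (inr i)) =
    join (env x) w by apply: funext => -[].
have E2 w w' : e w w' \o join (fun i => inl (inr i)) (fun i => inr i) = join w w'.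
  by apply: funext => -[].
have E3 w w' : e w w' \o join (fun i => inr i) (fun i => inl (inl (inr i))) = join w' (env y).
  by apply: funext => -[].
split=> [[w [w' []]]|[z [z' [hU hT hW]]]].
  rewrite !holds_rename -/(e w w') E1 E2 E3 => hU [hT hW].
  by exists (of_fun w), (of_fun w'); rewrite !env_of_fun.
by exists (env z), (env z'); rewrite !holds_rename -/(e _ _) E1 E2 E3.
Qed.

(** * Eliminating one state *)

Lemma uniq_insert (T : eqType) (s1 s2 : seq T) x :
  uniq (s1 ++ x :: s2) = (x \notin s1 ++ s2) && uniq (s1 ++ s2).
Proof. by rewrite -cat1s uniq_catCA. Qed.

Section Reachability.
Variables (N : nat) (S : choiceType).
Implicit Types (D : {fset transition N S}) (a b c q : S) (x y z : valuation N)
  (t u w : transition N S) (p : seq (transition N S)).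

(** Nonempty runs over an arbitrary set of transitions: elimination produces quantified labels,
    which a [program] does not admit. *)
Inductive reach D : S -> S -> valuation N -> valuation N -> Prop :=
| reach_one t x y : t \in D -> relation_of (label t) x y ->
    reach D (source t) (target t) x y
| reach_step t b x z y : t \in D -> relation_of (label t) x z ->
    reach D (target t) b z y -> reach D (source t) b x y.

Definition reach0 D a b x y : Prop := (a = b /\ x = y) \/ reach D a b x y.

Lemma reach_trans D a b c x z y : reach D a b x z -> reach D b c z y -> reach D a c x y.
Proof.
elim=> [t {}x {}z tD txz|t {}b {}x z' {}z tD txz _ IH] h; first exact: reach_step h.
exact: reach_step txz (IH h).
Qed.

Lemma reach0_step D t b x z y : t \in D -> relation_of (label t) x z ->
  reach0 D (target t) b z y -> reach D (source t) b x y.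
Proof. by move=> tD txz [[<- <-]|]; [apply: reach_one | apply: reach_step]. Qed.

Lemma reach0_trans D a b c x z y : reach0 D a b x z -> reach D b c z y -> reach D a c x y.
Proof. by case=> [[-> ->]//|]; apply: reach_trans. Qed.

Section Elimination.
Variables (D : {fset transition N S}) (q : S) (T : relform N).
Local Notation D' := (eliminate q T D).
Local Notation L := (labels_between D q q).

Lemma mem_labels_between R :
  R \in L <-> exists t, [/\ t \in D, source t = q, target t = q & R = label t].
Proof.
split=> [/imfsetP[t]|[t [tD st tt ->]]].
  by rewrite /= !inE => /andP[tD /andP[/eqP st /eqP tt]] ->; exists t.
by apply/imfsetP; exists t; rewrite //= !inE tD st tt eqxx.
Qed.

Lemma mem_eliminate t : t \in D' <->
  [/\ t \in D, source t != q & target t != q] \/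
  exists u w, [/\ u \in D /\ w \in D, source u != q /\ target u = q,
    source w = q /\ target w != q &
    t = (source u, comp3_form (label u) T (label w), target w)].
Proof.
rewrite in_fsetU; split=> [/orP[|/imfset2P[u /=]]|[[tD st tt]|[u [w]]]].
- by rewrite !inE => /and3P[]; left.
- rewrite !inE => /and3P[uD /eqP tu su] [w /=]; rewrite !inE => /and3P[wD /eqP sw tw] ->.
  by right; exists u, w.
- by rewrite !inE tD st tt.
- case=> -[uD wD] [su tu] [sw tw] ->; apply/orP; right.
  by apply/imfset2P; exists u; rewrite /= ?inE ?uD ?su ?tu ?eqxx //;
     exists w; rewrite //= !inE wD sw tw eqxx.
Qed.

Lemma eliminate_states t : t \in D' -> source t != q /\ target t != q.
Proof. by case/mem_eliminate=> [[]|[u [w [_ [su _] [_ tw] ->]]]]. Qed.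

Lemma loop_closure_over x y : loop_closure D q T ->
  clos_refl_trans _ (union_of L) x y -> relation_of T x y.
Proof.
move=> lT; suff [H LH eT] : exists2 H, (forall x y, union_of L x y -> H x y) &
    defines T (clos_refl_trans _ H).
  move=> h; apply/eT; elim: h => [{}x {}y /LH|{}x|{}x z {}y _ h1 _ h2].
  - exact: rt_step.
  - exact: rt_refl.
  - exact: rt_trans h1 h2.
case: lT => [[L0 ->]|[_ [H lH eT]]]; last first.
  by exists H => //; case: lH => [[_ ->]|[_ [C [LC _] ->]]].
exists (union_of L) => // x' y'; rewrite relation_of_id; split=> [->|]; first exact: rt_refl.
by rewrite L0; elim=> [{}x' {}y' [R]||{}x' z {}y' _ -> _ ->] //.
Qed.

Lemma reach_eliminate a b x y : loop_closure D q T -> a != q -> b != q ->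
  reach D a b x y -> reach D' a b x y.
Proof.
move=> lT aq bq h.
(* The induction on the run also meets suffixes that start at [q]. For these the invariant records
   the self-loops still to be taken, the transition [w] that leaves [q], and a run of the reduced
   system after it; a transition into [q] then completes the composed transition. *)
suff : if a == q then exists w z z', [/\ w \in D, source w = q /\ target w != q,
      clos_refl_trans _ (union_of L) x z, relation_of (label w) z z' &
      reach0 D' (target w) b z' y]
    else reach D' a b x y by rewrite (negbTE aq).
elim: h bq {aq} => {a b x y} [t x y tD txy|t b x z y tD txz _ IH] bq;
    case: ifPn => [/eqP st|st].
- by exists t, x, y; split=> //; [apply: rt_refl | left].
- by apply: reach_one => //; apply/mem_eliminate; left.
- have := IH bq; case: ifPn => [/eqP tt|tt] {}IH.
    have [w [z1 [z2 [wD sw hT hw hr]]]] := IH.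
    exists w, z1, z2; split=> //; apply: rt_trans hT; apply: rt_step.
    by exists (label t) => //; apply/mem_labels_between; exists t.
  by exists t, x, z; split=> //; [apply: rt_refl | right].
- have := IH bq; case: ifPn => [/eqP tt|tt] {}IH.
    have [w [z1 [z2 [wD [sw tw] hT hw hr]]]] := IH.
    pose t' : transition N S := (source t, comp3_form (label t) T (label w), target w).
    apply: (@reach0_step _ t') hr; first by apply/mem_eliminate; right; exists t, w.
    by apply/relation_of_comp3; exists z, z1; split=> //; apply: loop_closure_over.
  by apply: reach_step txz IH => //; apply/mem_eliminate; left.
Qed.

Definition exact_loops : Prop :=
  forall x y, relation_of T x y -> clos_refl_trans _ (union_of L) x y.

(** A single octagonal label is its own hull, and a single finite monoid affine label is iterated as
    it is. *)
Lemma exact_loops_hull : loop_closure D q T ->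
  (forall R, R \in L -> L = [fset R] /\
     (octagonal (relation_of R) \/ finite_monoid_affine (relation_of R))) ->
  exact_loops.
Proof.
case=> [[L0 eT] _ x y|[Ln0 [H lH eT]] L1 x y /eT].
  by rewrite eT relation_of_id => ->; apply: rt_refl.
suff -> : H = union_of L by [].
case: lH => [[_ //]|[nfma [C [LC hullC] ->]]].
have [R RL] : exists R, R \in L by case: (fset_0Vmem L) => [//|[R]]; exists R.
have [eL [[E ER]|fR]] := L1 R RL; last by case: nfma; exists R.
apply: relation_ext => {}x {}y; split=> [Cxy|/LC //].
rewrite eL union_of1; apply/ER; apply: (hullC E) Cxy => z z'.
by rewrite eL union_of1 => /ER.
Qed.

Lemma reach_loops x y : clos_refl_trans _ (union_of L) x y -> reach0 D q q x y.
Proof.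
elim=> [{}x {}y [R /mem_labels_between[t [tD st tt ->]] h]|{}x|{}x z {}y _ h1 _ h2].
- by right; rewrite -{1}st -tt; apply: reach_one.
- by left.
- by case: h2 h1 => [[_ ->]//|h2 h1]; right; apply: reach0_trans h1 h2.
Qed.

Lemma reach_eliminate_exact a b x y : exact_loops -> reach D' a b x y -> reach D a b x y.
Proof.
move=> exT.
have step t z z' : t \in D' -> relation_of (label t) z z' ->
    reach D (source t) (target t) z z'.
  case/mem_eliminate=> [[tD _ _]|[u [w [[uD wD] [_ tu] [sw _] ->]]]]; first exact: reach_one.
  case/relation_of_comp3=> z1 [z2 [hu /exT/reach_loops hT hw]].
  apply: reach_step hu _ => //; rewrite tu; apply: reach0_trans hT _.
  by rewrite -sw; apply: reach_one.
elim=> [t {}x {}y tD' /(step _ _ _ tD')//|t {}b {}x z {}y tD' h _ IH].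
exact: reach_trans (step _ _ _ tD' h) IH.
Qed.

End Elimination.

Definition edge_rel D a b : Prop := exists t, [/\ t \in D, source t = a & target t = b].

Definition recurrent D t : Prop :=
  t \in D /\ clos_refl_trans _ (edge_rel D) (target t) (source t).

(** The form of the first flatness condition that survives elimination. Transitions are compared
    with their labels, so parallel transitions on a cycle are excluded too. *)
Definition deterministic_cycles D : Prop :=
  forall t t', recurrent D t -> recurrent D t' -> source t = source t' -> t = t'.

Fixpoint path_between a p b : Prop :=
  match p with
  | [::] => a = b
  | t :: p' => source t = a /\ path_between (target t) p' b
  end.

Fixpoint path_relation p x y : Prop :=
  match p with
  | [::] => x = y
  | t :: p' => exists2 z, relation_of (label t) x z & path_relation p' z y
  end.

(** Stated on relations and not on the formulas [lambda], since elimination rewrites the labels of a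
    cycle but keeps the relation it defines. *)
Definition acceleratable_cycles D : Prop :=
  forall a p, p != [::] -> {subset p <= D} -> path_between a p a ->
    uniq [seq source t | t <- p] ->
    octagonal (path_relation p) \/ finite_monoid_affine (path_relation p).

Lemma path_between_cat a p p' b :
  path_between a (p ++ p') b <-> exists2 c, path_between a p c & path_between c p' b.
Proof.
elim: p a => [|t p IH] a /=; first by split=> [|[c ->]] //; exists a.
by rewrite IH; split=> [[st [c]]|[c [st]]]; [exists c | split=> //; exists c].
Qed.

Lemma path_relation_cat p p' x y :
  path_relation (p ++ p') x y <-> exists2 z, path_relation p x z & path_relation p' z y.
Proof.
elim: p x => [|t p IH] x /=; first by split=> [|[z ->]] //; exists x.
split=> [[z hz /IH[z' h h']]|[z' [z hz h] h']]; first by exists z' => //; exists z.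
by exists z => //; apply/IH; exists z'.
Qed.

Lemma path_between_clos D a p b :
  {subset p <= D} -> path_between a p b -> clos_refl_trans _ (edge_rel D) a b.
Proof.
elim: p a => [|t p IH] a pD /=; first by move=> ->; apply: rt_refl.
case=> <- h; apply: rt_trans (IH (target t) _ h); last first.
  by move=> u up; apply: pD; rewrite inE up orbT.
by apply: rt_step; exists t; split=> //; apply: pD; rewrite mem_head.
Qed.

Lemma cycle_recurrent D a p t :
  {subset p <= D} -> path_between a p a -> t \in p -> recurrent D t.
Proof.
move=> pD pa tp; split; first exact: pD.
case/splitPr: tp pD pa => p1 p2 pD /path_between_cat[c h1 /= [st h2]].
rewrite st; apply: rt_trans (path_between_clos _ h2) (path_between_clos _ h1) => u up;
  apply: pD.
  by rewrite mem_cat inE up !orbT.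
by rewrite mem_cat up.
Qed.

(** The targets of a closed path are its sources shifted by one position. *)
Lemma cycle_targets a p : path_between a p a -> uniq [seq source t | t <- p] ->
  uniq [seq target t | t <- p].
Proof.
have shift b c : path_between b p c ->
    rcons [seq source t | t <- p] c = b :: [seq target t | t <- p].
  elim: p b => [|t p IH] b /=; first by move=> ->.
  by case=> <- /IH ->.
move=> /shift e us; move: us; have : perm_eq (rcons [seq source t | t <- p] a)
  (a :: [seq target t | t <- p]) by rewrite e.
by rewrite perm_rcons perm_cons => /perm_uniq ->.
Qed.

(** * Elimination preserves flatness *)

Section FlatElimination.
Variables (D : {fset transition N S}) (q : S) (T : relform N).
Hypotheses (detD : deterministic_cycles D) (lT : loop_closure D q T).
Local Notation D' := (eliminate q T D).
Local Notation L := (labels_between D q q).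

Lemma edge_eliminate a b :
  clos_refl_trans _ (edge_rel D') a b -> clos_refl_trans _ (edge_rel D) a b.
Proof.
elim=> [{}a {}b [t [/mem_eliminate tD' <- <-]]|{}a|{}a c {}b _ h1 _ h2].
case: tD' => [[tD _ _]|[u [w [[uD wD] [_ tu] [sw _] ->]]]].
- by apply: rt_step; exists t.
- apply: (@rt_trans _ _ _ q); apply: rt_step; [by exists u | by exists w].
- exact: rt_refl.
- exact: rt_trans h1 h2.
Qed.

(** A cycle through a composed transition unfolds into a cycle of [D] through both of its halves. *)
Lemma recurrent_eliminate t : recurrent D' t ->
  [/\ recurrent D t, source t != q & target t != q] \/
  exists u w, [/\ recurrent D u /\ recurrent D w, source u != q /\ target u = q,
    source w = q /\ target w != q &
    t = (source u, comp3_form (label u) T (label w), target w)].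
Proof.
case=> /mem_eliminate[[tD st tt] /edge_eliminate h|]; first by left.
case=> u [w [[uD wD] [su tu] [sw tw] ->]] /edge_eliminate h; right; exists u, w.
have uq : clos_refl_trans _ (edge_rel D) (source u) q by apply: rt_step; exists u.
have qw : clos_refl_trans _ (edge_rel D) q (target w) by apply: rt_step; exists w.
split=> //; split; split=> //; first by rewrite tu; apply: rt_trans qw h.
by rewrite sw; apply: rt_trans h uq.
Qed.

(** A composed recurrent transition is determined by its source, which fixes its first half [u], and
    by the only recurrent transition leaving [q]. It cannot share its source with a kept one,
    because [u] ends in [q] and the kept one does not. *)
Lemma deterministic_eliminate : deterministic_cycles D'.
Proof.
move=> t t' /recurrent_eliminate ht /recurrent_eliminate ht' st.
case: ht st => [[rt st tt]|[u [w [[ru rw] [su tu] [sw tw] ->]]]].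
  case: ht' => [[rt' st' tt'] e|[u [w [[ru rw] [su tu] [sw tw] ->]]] /= e].
    exact: detD.
  by move: tt; rewrite (detD rt ru e) tu eqxx.
case: ht' => [[rt' st' tt'] /= e|[u' [w' [[ru' rw'] [su' tu'] [sw' tw'] ->]]] /= e].
  by move: tt'; rewrite -(detD ru rt' e) tu eqxx.
by rewrite (detD ru ru' e) (detD rw rw' (etrans sw (esym sw'))).
Qed.

(** An elementary cycle contains at most one composed transition. Replacing it by its two halves
    gives an elementary cycle of [D] through [q] with the same relation. *)
Lemma acceleratable_eliminate : acceleratable_cycles D -> acceleratable_cycles D'.
Proof.
move=> accD a p pn pD' pa us.
case: (pselect ({subset p <= D})) => [pD|npD]; first exact: (accD a p).
have [t tp ntD] : exists2 t, t \in p & t \notin D.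
  apply: contrapT => h; apply: npD => t tp; apply: contrapT => ntD.
  by apply: h; exists t => //; apply/negP.
have rec v : v \in p -> recurrent D' v by apply: cycle_recurrent pa.
have ut := cycle_targets pa us.
have [[[tD _] _ _]|[u [w [[ru rw] [su tu] [sw tw] et]]]] := recurrent_eliminate (rec t tp).
  by rewrite tD in ntD.
(* The second half [w] is the only recurrent transition leaving [q], so [q] has no self-loop and [T]
   is the identity. *)
have L0 : L = fset0.
  apply/eqP; apply/negPn/negP => /fset0Pn[R /mem_labels_between[l [lD sl tl _]]].
  have rl : recurrent D l by split=> //; rewrite tl sl; apply: rt_refl.
  by move: tw; rewrite -(detD rl rw (etrans sl (esym sw))) tl eqxx.
have Tid z z' : relation_of T z z' <-> z = z'.
  by case: lT => [[_ eT]|[]//]; rewrite eT; apply: relation_of_id.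
have qp : q \notin [seq source v | v <- p].
  by apply/mapP => -[v /pD'/eliminate_states[+ _] e]; rewrite -e eqxx.
case/splitPr: tp pn pD' pa us rec ut qp {npD} => p1 p2 _ pD' pa us rec ut qp.
(* A second composed transition would also end with [w], hence have the same target as [t], whereas
   the targets of the cycle are distinct. *)
have others v : v \in p1 ++ p2 -> v \in D.
  move=> vp; have vp' : v \in p1 ++ t :: p2.
    by move: vp; rewrite !mem_cat inE => /orP[] ->; rewrite ?orbT.
  have [[[]//]|[u' [w' [[_ rw'] _ [sw' _] ev]]]] := recurrent_eliminate (rec v vp').
  have tv : target v = target t by rewrite ev et /= (detD rw rw' (etrans sw (esym sw'))).
  move: ut; rewrite map_cat /= uniq_insert -map_cat => /andP[/negP[]].
  by rewrite -tv; apply: map_f.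
have <- : path_relation (p1 ++ u :: w :: p2) = path_relation (p1 ++ t :: p2).
  apply: relation_ext => x y; rewrite !path_relation_cat /=.
  split=> [[z h1 [z1 hu [z2 hw h2]]]|[z h1 [z2]]].
    exists z => //; exists z2 => //; rewrite et; apply/relation_of_comp3.
    by exists z1, z1; split=> //; apply/Tid.
  rewrite et => /relation_of_comp3[z1 [z1' [hu /Tid <- hw]]] h2.
  by exists z => //; exists z1 => //; exists z2.
apply: (accD a) => [|v||].
- by case: (p1).
- rewrite mem_cat !inE => /or4P[vp|/eqP->|/eqP->|vp].
  + by apply: others; rewrite mem_cat vp.
  + by case: ru.
  + by case: rw.
  + by apply: others; rewrite mem_cat vp orbT.
- case/path_between_cat: pa => c h1 /= [st h2]; apply/path_between_cat; exists c => //=.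
  by have {}st : source u = c by [rewrite -st et]; move: h2; rewrite et sw tu.
- have st : source t = source u by rewrite et.
  move: us qp; rewrite !map_cat /= st sw -!cat_rcons => us qp.
  by rewrite cat_rcons uniq_insert qp.
Qed.

(** A self-loop is recurrent, so [q] has at most one, and it is an elementary cycle of length
    one. *)
Lemma exact_eliminate : acceleratable_cycles D -> exact_loops D q T.
Proof.
move=> accD; apply: exact_loops_hull => // R /mem_labels_between[t [tD st tt ->]].
have loop_rec u : u \in D -> source u = q -> target u = q -> recurrent D u.
  by move=> uD su tu; split=> //; rewrite su tu; apply: rt_refl.
split.
  apply/fsetP => R'; rewrite inE; apply/idP/eqP => [/mem_labels_between[u [uD su tu ->]]|->].
    by rewrite (detD (loop_rec _ uD su tu) (loop_rec _ tD st tt)) ?su ?st.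
  by apply/mem_labels_between; exists t.
suff <- : path_relation [:: t] = relation_of (label t).
  by apply: (accD q) => //= u; rewrite inE => /eqP ->.
by apply: relation_ext => x y /=; split=> [[z h <-]|h]; last exists y.
Qed.

End FlatElimination.
End Reachability.

(** * Flat programs and the working copy *)

Section FlatPrograms.
Variables (N : nat) (S : choiceType) (D : {fset transition N S}).

(** If the source of a prepended edge already occurs, the path is cut back to that occurrence. The
    sources avoid [a], so a transition from [a] to [b] closes the path into an elementary cycle. *)
Lemma simple_path a b : clos_refl_trans _ (edge_rel D) b a ->
  exists p, [/\ {subset p <= D}, path_between b p a,
    uniq [seq source t | t <- p] & a \notin [seq source t | t <- p]].
Proof.
move=> h0; have h := clos_rt_rt1n _ _ _ _ h0; elim: h {h0} => {a b}
    [a|b c a [t [tD st tt]] _ [p [pD pa us nap]]].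
  by exists [::].
have [bp|nbp] := boolP (b \in [seq source t | t <- p]).
  case/mapP: bp pD pa us nap => u + su; case/splitPr=> p1 p2 pD /path_between_cat[d _ h2].
  rewrite map_cat cat_uniq mem_cat negb_or => /and3P[_ _ us] /andP[_ nap].
  exists (u :: p2); split=> //; first by move=> v vp; apply: pD; rewrite mem_cat vp orbT.
  by case: h2 => _ h2; split.
have [->|nab] := eqVneq a b; first by exists [::].
exists (t :: p); split=> /=.
- by move=> u; rewrite inE => /predU1P[->|/pD].
- by split=> //; rewrite tt.
- by rewrite st nbp.
- by rewrite inE st negb_or nab.
Qed.

Lemma path_between_cycle (p : seq (transition N S)) a : path_between a p a ->
  cycle (fun t t' => target t == source t') p.
Proof.
have pathP b t (p' : seq (transition N S)) c : path_between b (t :: p') c ->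
    path (fun t t' => target t == source t') t p' /\ target (last t p') = c.
  elim: p' b t => [|t' p' IH] b t /=; first by case.
  by case=> _ [st' h]; have [|h1 h2] := IH (source t') t'; rewrite //= st' eqxx.
case: p => [//|t p] h; have [h1 h2] := pathP _ _ _ _ h.
by rewrite /= rcons_path h1 h2; case: h => ->; rewrite eqxx.
Qed.

End FlatPrograms.

Lemma relation_of_lambda (N : nat) (Q : finType) (p : seq (transition N Q)) :
  p != [::] -> relation_of (lambda p) = path_relation p.
Proof.
case: p => [//|t p] _; elim: p t => [|t' p IH] t; apply: relation_ext => x y.
  by split=> [h|[z h <-]] //; exists y.
by rewrite relation_of_comp IH; split=> [[z [h h']]|[z h h']]; exists z.
Qed.

Section WorkingCopy.
Variables (N : nat) (Q : finType) (P : program N Q) (qin qout : Q).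
Hypothesis qin_qout : qin != qout.

Local Notation W := (working_copy P qin qout).
Local Notation bar_in := (bar_in Q).
Local Notation bar_out := (bar_out Q).

Definition lift_rule (t : transition N Q) : transition N (wstate Q) :=
  (old (source t), label t, old (target t)).

Lemma mem_working_copy t : t \in W <->
  [\/ exists2 t0, t0 \in rules P & t = lift_rule t0,
      t = (bar_in, id_form N, old qin) | t = (old qout, id_form N, bar_out)].
Proof.
rewrite !inE; split=> [/or3P[/imfsetP[t0 /= tP ->]|/eqP->|/eqP->]|[[t0 tP ->]|->|->]].
- by constructor 1; exists t0.
- by constructor 2.
- by constructor 3.
- by apply/orP; left; apply/imfsetP; exists t0.
- by rewrite eqxx orbT.
- by rewrite eqxx !orbT.
Qed.

Lemma reach_plus_reach a b x y : reach_plus P a b x y <-> reach (rules P) a b x y.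
Proof.
split=> [[s [s1 rs ls]]|].
  elim: s a x s1 rs ls => [//|[c z] s IH] a x _ /= [[t [tP /= st tt h]] rs] ls.
  rewrite -st; case: s => [|d s] in rs ls IH *.
    by case: ls => <- <-; rewrite -tt; apply: reach_one.
  by apply: reach_step tP h _; rewrite tt; apply: IH.
elim=> [t {}x {}y tP h|t {}b {}x z {}y tP h _ [s [s1 rs ls]]].
  by exists [:: (target t, y)]; split=> //=; split=> //; exists t.
by exists ((target t, z) :: s); split=> //=; split=> //; exists t.
Qed.

Lemma reach_working_copy x y :
  reach W bar_in bar_out x y <-> reach_plus P qin qout x y.
Proof.
rewrite reach_plus_reach; split=> [|h].
  (* The bar states only add identity steps, so what remains inside [P] could be an empty run;
     [qin != qout] rules this out for the full run. *)
  pose claim (u v : wstate Q) x y := v = bar_out ->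
    match u with
    | inl a => reach0 (rules P) a qout x y
    | inr true => reach0 (rules P) qin qout x y
    | inr false => False
    end.
  suff cl u v x' y' : reach W u v x' y' -> claim u v x' y'.
    by move=> /cl /(_ erefl)[[e _]|//]; case/eqP: qin_qout.
  elim=> {u v x' y'} [t x' y' /mem_working_copy[[t0 tP ->]|->|->] h //|
    t v x' z y' /mem_working_copy[[t0 tP ->]|->|->] h _ IH] //.
  - by move=> _; left; move/relation_of_id: h.
  - by move/IH => {}IH; right; apply: reach0_step IH.
  - by move/IH; move/relation_of_id: h => ->.
  - by move/IH.
have lift a b x' y' : reach (rules P) a b x' y' -> reach W (old a) (old b) x' y'.
  elim=> [t {}x' {}y' tP h'|t {}b {}x' z {}y' tP h' _ IH].
    apply: (@reach_one _ _ _ (lift_rule t)) => //; apply/mem_working_copy.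
    by constructor 1; exists t.
  apply: (@reach_step _ _ _ (lift_rule t)) h' IH.
  by apply/mem_working_copy; constructor 1; exists t.
pose tin : transition N (wstate Q) := (bar_in, id_form N, old qin).
pose tout : transition N (wstate Q) := (old qout, id_form N, bar_out).
apply: (@reach_step _ _ _ tin _ _ x); first by apply/mem_working_copy; constructor 2.
  exact/relation_of_id.
apply: reach_trans (lift _ _ _ _ h) _; apply: (@reach_one _ _ _ tout).
  by apply/mem_working_copy; constructor 3.
exact/relation_of_id.
Qed.

Lemma edge_working_copy u v : clos_refl_trans _ (edge_rel W) u v ->
  forall a b, u = old a -> v = old b -> clos_refl_trans _ (edge_rel (rules P)) a b.
Proof.
move=> h0; have h := clos_rt_rt1n _ _ _ _ h0; elim: h {h0} => {u v} [u a b -> [->]|u w v].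
  exact: rt_refl.
case=> t [/mem_working_copy[[t0 tP ->]|->|->] <- <-] // h IH a b.
  move=> [<-] eb; apply: rt_trans (IH _ _ erefl eb).
  by apply: rt_step; exists t0.
move=> _ eb; move: h; rewrite eb => h; exfalso.
have : forall u v, clos_refl_trans_1n _ (edge_rel W) u v -> u = bar_out -> v = bar_out.
  move=> u' v'; elim=> // {}u' w' {}v' [t' [/mem_working_copy[[t0 _ ->]|->|->] <- <-]] //.
by move=> /(_ _ _ h erefl).
Qed.

(** Nothing enters [bar_in] and nothing leaves [bar_out], so the two added transitions lie on no
    cycle. *)
Lemma recurrent_working_copy t : recurrent W t ->
  exists2 t0, recurrent (rules P) t0 & t = lift_rule t0.
Proof.
have no_in u v : clos_refl_trans _ (edge_rel W) u v -> v = bar_in -> u = bar_in.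
  move=> h0; have h := clos_rt_rtn1 _ _ _ _ h0;
  elim: h {h0} => // w z [t' [/mem_working_copy[[t0 _ ->]|->|->] <- <-]] //.
have no_out u v : clos_refl_trans _ (edge_rel W) u v -> u = bar_out -> v = bar_out.
  move=> h0; have h := clos_rt_rt1n _ _ _ _ h0;
  elim: h {h0} => // {}u w {}v [t' [/mem_working_copy[[t0 _ ->]|->|->] <- <-]] //.
case=> /mem_working_copy[[t0 tP ->]|->|->] h.
- by exists t0 => //; split=> //; apply: edge_working_copy h _ _ erefl erefl.
- by have := no_in _ _ h erefl.
- by have := no_out _ _ h erefl.
Qed.

(** Two recurrent rules with the same source lie on elementary cycles through it. These are
    rotations of each other and visit that source only once, so the two rules coincide. *)
Lemma flat_deterministic : flat P -> deterministic_cycles W.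
Proof.
case=> rot_cycle _ t t' /recurrent_working_copy[u ru ->] /recurrent_working_copy[v rv ->].
case=> suv; congr lift_rule.
have cyc w : recurrent (rules P) w -> exists p,
    elementary_cycle P (w :: p) /\ source w \notin [seq source t | t <- p].
  case=> wP /simple_path[p [pD pa us nap]]; exists p; split=> //; split=> //.
  - by move=> z; rewrite inE => /predU1P[->|/pD].
  - by apply: (@path_between_cycle _ _ _ (source w)).
  - by rewrite /= nap.
have [p [cp np]] := cyc u ru; have [p' [cp' np']] := cyc v rv.
have [||i e] := rot_cycle _ _ (source u) cp cp'; rewrite ?mem_head //.
  by rewrite /= suv mem_head.
have : v \in u :: p by rewrite -(mem_rot i) -e mem_head.
rewrite inE => /predU1P[//|vp]; case/negP: np.
by rewrite suv; apply: map_f.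
Qed.

(** Elementary cycles of the working copy avoid the added transitions, so they are lifted from
    elementary cycles of [P]. *)
Lemma flat_acceleratable : flat P -> acceleratable_cycles W.
Proof.
case=> _ accP u p pn pW pu us.
have [p0 p0P ep] : exists2 p0, {subset p0 <= rules P} & p = [seq lift_rule t | t <- p0].
  have : forall t, t \in p -> exists2 t0, t0 \in rules P & t = lift_rule t0.
    by move=> t /(cycle_recurrent pW pu)/recurrent_working_copy[t0 [tP _] ->]; exists t0.
  elim: (p) => [|t r IH] h; first by exists [::].
  have [t0 tP et] := h t (mem_head _ _).
  have [|r0 rP er] := IH; first by move=> v vr; apply: h; rewrite inE vr orbT.
  exists (t0 :: r0); last by rewrite /= et er.
  by move=> v; rewrite inE => /predU1P[->|/rP].
have sub v r w : path_between v [seq lift_rule t | t <- r] w ->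
    forall a b, v = old a -> w = old b -> path_between a r b.
  elim: r v => [|t r IH] v /= => [-> a b -> [] //|[<- h] a b [<-] eb].
  by split=> //; apply: IH h _ _ erefl eb.
have rel_p : path_relation p = path_relation p0.
  apply: relation_ext => x y; rewrite ep; elim: p0 x {p0P ep} => //= t r IH x.
  by split=> -[z h /IH h']; exists z.
rewrite rel_p -relation_of_lambda; last by case: (p0) ep pn => // ->.
apply: accP; split=> //; first by case: (p0) ep pn => // ->.
  case: p0 ep {p0P rel_p} pn => [|t p0] ep pn //.
  have pu' : path_between (source (lift_rule t)) p (source (lift_rule t)).
    by move: pu; rewrite ep /= => -[<-].
  apply: (@path_between_cycle _ _ _ (source t)).
  by rewrite ep in pu'; apply: sub pu' _ _ erefl erefl.
move: us; rewrite ep -map_comp (eq_map (g := @old Q \o @source N Q)) // map_comp.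
by apply: map_uniq.
Qed.

(** * Elimination of a sequence of states and the output formula *)

Lemma eliminates_exists (S : choiceType) (s : seq S) (D : {fset transition N S}) :
  exists D', eliminates s D D'.
Proof.
elim: s D => [|q s IH] D; first by exists D; constructor.
have [T lT] := loop_closure_exists D q; have [D' eD] := IH (eliminate q T D).
by exists D'; apply: eliminates_cons lT eD.
Qed.

Lemma eliminates_over (S : choiceType) (s : seq S) (D D' : {fset transition N S}) a b x y :
  eliminates s D D' -> a \notin s -> b \notin s -> reach D a b x y -> reach D' a b x y.
Proof.
elim=> [//|q {}s {}D T {}D' lT _ IH].
rewrite !inE !negb_or => /andP[aq a_s] /andP[bq bs] h; apply: IH => //.
exact: reach_eliminate lT aq bq h.
Qed.

Lemma eliminates_exact (S : choiceType) (s : seq S) (D D' : {fset transition N S}) a b x y :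
  eliminates s D D' -> deterministic_cycles D -> acceleratable_cycles D ->
  reach D' a b x y -> reach D a b x y.
Proof.
elim=> [//|q {}s {}D T {}D' lT _ IH] detD accD h.
apply: (@reach_eliminate_exact _ _ _ q T); first exact: exact_eliminate.
by apply: IH h; [apply: deterministic_eliminate | apply: acceleratable_eliminate].
Qed.

(** Sources and targets are inherited from [D], so [bar_in] never becomes a target nor [bar_out] a
    source. *)
Lemma eliminates_states (S : choiceType) (s : seq S) (D D' : {fset transition N S}) t :
  eliminates s D D' -> t \in D' ->
  [/\ source t \notin s, target t \notin s,
      exists2 u, u \in D & source u = source t & exists2 u, u \in D & target u = target t].
Proof.
elim=> [{}D tD|q {}s {}D T {}D' lT _ IH /IH[sts tts [u uD su] [v vD tv]]].
  by split=> //; exists t.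
have [suq _] := eliminate_states uD; have [_ tvq] := eliminate_states vD.
rewrite !inE -su -tv !negb_or suq tvq su tv; split=> //.
  case/mem_eliminate: uD => [[uD _ _]|[w [w0 [[wD _] _ _ eu]]]]; first by exists u.
  by exists w => //; rewrite -su eu.
case/mem_eliminate: vD => [[vD _ _]|[w0 [w [[_ wD] _ _ ev]]]]; first by exists v.
by exists w => //; rewrite -tv ev.
Qed.

Lemma holds_disj_form (R : seq (relform N)) x y :
  relation_of (disj_form R) x y <-> exists2 r, r \in R & relation_of r x y.
Proof.
rewrite /relation_of /disj_form; elim: R => [|r R IH].
  by rewrite big_nil; split=> // -[].
rewrite big_cons /= IH; split=> [[h|[r' rR h]]|[r']].
- by exists r; rewrite ?mem_head.
- by exists r'; rewrite // inE rR orbT.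
- by rewrite inE => /predU1P[->|rR] h; [left | right; exists r'].
Qed.

(** After all original states are gone, every transition leads from [bar_in] to [bar_out], so every
    run has length one. *)
Lemma output_reach (order : seq Q) (D : {fset transition N (wstate Q)}) x y :
  (forall q, q \in order) -> eliminates [seq old q | q <- order] W D ->
  relation_of (disj_form (labels_between D bar_in bar_out)) x y <-> reach D bar_in bar_out x y.
Proof.
move=> all_order eD.
have ends t : t \in D -> source t = bar_in /\ target t = bar_out.
  case/(eliminates_states eD) => st tt [u uW su] [v vW tv].
  have bar (w : wstate Q) : w \notin [seq old q | q <- order] -> exists b, w = inr b.
    by case: w => [q|b] //; [rewrite map_f | exists b].
  have [b sb] := bar _ st; have [b' tb'] := bar _ tt.
  move: su tv; rewrite sb tb' => su tv.
  by case/mem_working_copy: uW su => [[t0 _ ->]|->|->] //= <-;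
     case/mem_working_copy: vW tv => [[t0 _ ->]|->|->] //= <-.
rewrite holds_disj_form; split.
  case=> r /imfsetP[t /=]; rewrite !inE => /and3P[tD /eqP st /eqP tt] -> h.
  by rewrite -{1}st -tt; apply: reach_one.
suff only_one u v x' y' : reach D u v x' y' -> u = bar_in ->
    exists2 r, r \in labels_between D bar_in bar_out & relation_of r x' y'.
  by move/only_one; apply.
case=> {u v x' y'} [t x' y' tD h|t v x' z y' tD h hr] _; last first.
  have [_ tt] := ends t tD; rewrite tt in hr.
  suff no u v' z' w : reach D u v' z' w -> u <> bar_out by case: (no _ _ _ _ hr).
  by case=> [t' {}z' {}w /ends[-> _]|t' {}v' {}z' z1 {}w /ends[-> _]].
have [st tt] := ends t tD; exists (label t) => //.
by apply/imfsetP; exists t; rewrite //= !inE tD st tt !eqxx.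
Qed.

End WorkingCopy.

Theorem lemma6p4 (N : nat) (Q : finType) (P : program N Q) (qin qout : Q)
    (order : seq Q) (hq : qin != qout) (horder : perm_eq order (enum Q)) :
  (exists phi : relform N, transitive_relation P qin qout order phi) /\
  (forall phi : relform N, transitive_relation P qin qout order phi ->
     (forall nu nu' : valuation N,
        reach_plus P qin qout nu nu' -> relation_of phi nu nu') /\
     (flat P -> defines phi (reach_plus P qin qout))).
Proof.
have all_order q : q \in order by rewrite (perm_mem horder) mem_enum.
have bar_notin_order b : inr b \notin [seq old q | q <- order] by apply/mapP => -[].
split.
  have [D eD] := eliminates_exists [seq old q | q <- order] (working_copy P qin qout).
  by exists (disj_form (labels_between D (bar_in Q) (bar_out Q))); exists D.
move=> phi [D eD ->].
have over nu nu' : reach_plus P qin qout nu nu' ->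
    relation_of (disj_form (labels_between D (bar_in Q) (bar_out Q))) nu nu'.
  move/(reach_working_copy P hq) => h; apply/(output_reach _ _ all_order eD).
  exact: (eliminates_over eD (bar_notin_order true) (bar_notin_order false)) h.
split=> // flatP nu nu'; split=> [/(output_reach _ _ all_order eD) h|]; last exact: over.
apply/(reach_working_copy P hq); apply: eliminates_exact eD _ _ h.
  exact: flat_deterministic.
exact: flat_acceleratable.
Qed.
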